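(* Let $\zeta\in S=\mathbf{C}[[X^{1/m},Y^{1/m}]]$ be a Puiseux power series having no exponent in $(m\mathbf{Z})^2$, let $F(Z)\in R[Z]$ be its minimal polynomial over $K$, let $n=[K(\zeta):K]=\deg_Z F$, and let $\mathcal{S}=\mathrm{Spec}(\mathbf{C}[[X,Y,Z]]/(F))$ be the Puiseux surface defined by $\zeta$. Then: (a) If $\nu(\zeta)>1$, the equation of the tangent cone of $\mathcal{S}$ is $Z^n=0$. (b) If $\nu(\zeta)=1$, the equation of the tangent cone of $\mathcal{S}$ is the $d(\overline{\zeta})/d(\zeta)$-th power of an irreducible polynomial, namely of the minimal polynomial over $K$ of the initial form $\overline{\zeta}$ of $\zeta$. (c) If $\nu(\zeta)<1$, the equation of the tangent cone of $\mathcal{S}$ is a product of linear forms.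
   Context: Fix a positive integer $m$. Let $R=\mathbf{C}[[X,Y]]$, $S=\mathbf{C}[[X^{1/m},Y^{1/m}]]$, and let $K=\mathbf{C}((X,Y))$ and $L=\mathbf{C}((X^{1/m},Y^{1/m}))$ be the fraction fields of $R$ and $S$. ($\mathbf{C}$ may be replaced by any algebraically closed field of characteristic $0$.) Elements of $S$ are called Puiseux power series. For $\zeta=\sum_{(i,j)\in\Delta(\zeta)}c_{ij}X^{i/m}Y^{j/m}$ with all $c_{ij}\neq0$, $\Delta(\zeta)\subset\mathbf{N}^2$ is called the set of exponents of $\zeta$. The order $\nu$ on $S$ is the usual one, with $\nu(X^{i/m}Y^{j/m})=(i+j)/m$. The initial form $\overline{\zeta}$ is the sum of the terms of $\zeta$ of lowest order $\nu(\zeta)$. Standing assumption: all Puiseux power series considered satisfy $\Delta(\zeta)\cap(m\mathbf{Z})^2=\emptyset$. An embedded algebroid surface $\mathrm{Spec}(\mathbf{C}[[X,Y,Z]]/(F))$ is a Puiseux surface if the roots of $F$ (as a polynomial in $Z$) are Puiseux power series; it is said to be defined by $\zeta\in S$ if it is irreducible and $F$ is the minimal polynomial of $\zeta$ over $K$. A finite set $\{(i_1,j_1),\dots,(i_t,j_t)\}\subset\Delta(\zeta)$ is a set of privileged exponents of $\zeta$ if $K(\zeta)=K(X^{i_1/m}Y^{j_1/m},\dots,X^{i_t/m}Y^{j_t/m})$. The integer $d(\zeta)$ is the gcd of the $2\times2$ minors of the matrix $$\begin{pmatrix} m&0&i_1&\cdots&i_t\\0&m&j_1&\cdots&j_t\end{pmatrix}$$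 for any set of privileged exponents; it is known that such sets exist, that $d(\zeta)$ does not depend on the chosen set, and that $[K(\zeta):K]=m^2/d(\zeta)$. The tangent cone of the surface $\mathrm{Spec}(\mathbf{C}[[X,Y,Z]]/(F))$ is the affine variety (with multiplicities) defined by the initial form of $F$, i.e. the lowest-degree homogeneous part of $F$ in $X,Y,Z$; ''the equation of the tangent cone'' means this initial form, up to a nonzero constant factor. *)

(* Defs.v *)
From HB Require Import structures.
From mathcomp Require Import all_boot all_order all_algebra.
From mathcomp Require Import mpoly.
From mathcomp Require Import boolp classical_sets constructive_ereal.

Set Implicit Arguments.
Unset Strict Implicit.
Unset Printing Implicit Defensive.

Import Order.TTheory GRing.Theory Num.Theory.

Local Open Scope ring_scope.

Record fps (A : Type) := Fps { fcoef : nat -> A }.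

Notation "{ 'fps' A }" := (fps A) (at level 0, format "{ 'fps'  A }").

Lemma fpsP (A : Type) (f g : {fps A}) : fcoef f =1 fcoef g -> f = g.
Proof. by case: f g => [f] [g] /= /funext ->. Qed.

HB.instance Definition _ (A : Type) := gen_eqMixin {fps A}.
HB.instance Definition _ (A : Type) := gen_choiceMixin {fps A}.

Section Zmodule.
Variable A : zmodType.
Implicit Types f g : {fps A}.

Definition fps_zero : {fps A} := Fps (fun=> 0).
Definition fps_opp f := Fps (fun n => - fcoef f n).
Definition fps_add f g := Fps (fun n => fcoef f n + fcoef g n).

Fact fps_addA : associative fps_add.
Proof. by move=> f g h; apply: fpsP => n /=; rewrite addrA. Qed.
Fact fps_addC : commutative fps_add.
Proof. by move=> f g; apply: fpsP => n /=; rewrite addrC. Qed.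
Fact fps_add0 : left_id fps_zero fps_add.
Proof. by move=> f; apply: fpsP => n /=; rewrite add0r. Qed.
Fact fps_addN : left_inverse fps_zero fps_opp fps_add.
Proof. by move=> f; apply: fpsP => n /=; rewrite addNr. Qed.

HB.instance Definition _ :=
  GRing.isZmodule.Build {fps A} fps_addA fps_addC fps_add0 fps_addN.

End Zmodule.

Section Ring.
Variable A : comNzRingType.
Implicit Types f g h : {fps A}.

Definition fps_one : {fps A} := Fps (fun n => (n == 0%N)%:R).
Definition fps_mul f g : {fps A} :=
  Fps (fun n => \sum_(i < n.+1) fcoef f i * fcoef g (n - i)).

Fact fps_mul_trunc f g n k : (k <= n)%N ->
  fcoef (fps_mul f g) k =
  ((\poly_(i < n.+1) fcoef f i) * (\poly_(i < n.+1) fcoef g i))`_k.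
Proof.
move=> kn; rewrite coefM /=; apply: eq_bigr => i _.
have lt_in : (i < n.+1)%N by rewrite ltnS (leq_trans _ kn) // -ltnS.
by rewrite !coef_poly lt_in ltnS (leq_trans (leq_subr _ _) kn).
Qed.

Fact fps_poly_mul f g n k : (k <= n)%N ->
  (\poly_(i < n.+1) fcoef (fps_mul f g) i)`_k =
  ((\poly_(i < n.+1) fcoef f i) * (\poly_(i < n.+1) fcoef g i))`_k.
Proof. by move=> kn; rewrite coef_poly ltnS kn; apply: fps_mul_trunc. Qed.

Fact fps_mulC : commutative fps_mul.
Proof.
move=> f g; apply: fpsP => n.
by rewrite !(@fps_mul_trunc _ _ n) // mulrC.
Qed.

Fact fps_mulA : associative fps_mul.
Proof.
move=> f g h; apply: fpsP => n; rewrite !(@fps_mul_trunc _ _ n) //.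
transitivity ((\poly_(i < n.+1) fcoef f i) * (\poly_(i < n.+1) fcoef g i)
                * (\poly_(i < n.+1) fcoef h i))`_n.
  rewrite -mulrA !coefM; apply: eq_bigr => i _.
  by rewrite fps_poly_mul // leq_subr.
rewrite coefM [RHS]coefM; apply: eq_bigr => i _.
by rewrite fps_poly_mul // -ltnS.
Qed.

Fact fps_mul1 : left_id fps_one fps_mul.
Proof.
move=> f; apply: fpsP => n /=.
by rewrite big_ord_recl /= mul1r subn0 big1 ?addr0 // => i _; rewrite mul0r.
Qed.

Fact fps_mulDl : left_distributive fps_mul +%R.
Proof.
move=> f g h; apply: fpsP => n /=; rewrite -big_split /=.
by apply: eq_bigr => i _; rewrite mulrDl.
Qed.

Fact fps_oner_neq0 : fps_one != 0.
Proof.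
by apply/eqP => /(congr1 (fun f => fcoef f 0%N)) /= /eqP; rewrite oner_eq0.
Qed.

HB.instance Definition _ := GRing.Zmodule_isComNzRing.Build {fps A}
  fps_mulA fps_mulC fps_mul1 fps_mulDl fps_oner_neq0.

Definition fps_unit : pred {fps A} := fun f => `[< exists g, g * f = 1 >].
Definition fps_inv f : {fps A} := xget f [set g | g * f = 1]%classic.

Fact fps_mulVr : {in fps_unit, left_inverse 1 fps_inv *%R}.
Proof.
move=> f; rewrite unfold_in => /asboolP[g gf1].
exact: (@xgetPex _ f [set g | g * f = 1]%classic (ex_intro _ g gf1)).
Qed.
Fact fps_unitPl f g : g * f = 1 -> fps_unit f.
Proof. by move=> gf1; apply/asboolP; exists g. Qed.
Fact fps_inv_out : {in [predC fps_unit], fps_inv =1 id}.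
Proof.
move=> f; rewrite inE unfold_in => /asboolPn nf.
by apply: xgetPN => g /= gf1; apply: nf; exists g.
Qed.

HB.instance Definition _ := GRing.ComNzRing_hasMulInverse.Build {fps A}
  fps_mulVr fps_unitPl fps_inv_out.

End Ring.

Section IntegralDomain.
Variable A : idomainType.

Fact fps_integral (f g : {fps A}) : f * g = 0 -> (f == 0) || (g == 0).
Proof.
have least (h : {fps A}) : h != 0 ->
    exists2 n, fcoef h n != 0 & forall k, (k < n)%N -> fcoef h k = 0.
  move=> h0; have /ex_minnP[n hn hmin] : exists n, fcoef h n != 0.
    apply: contrapT => h_eq0; move/eqP: h0; apply; apply: fpsP => n.
    by apply/eqP; apply: contrapT => /negP hn; apply: h_eq0; exists n.
  exists n => // k kn; apply/eqP; apply: contraTT kn => /hmin.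
  by rewrite -leqNgt.
move=> fg0; apply/norP => -[/least[i fi0 fi] /least[j gj0 gj]].
have /eqP := congr1 (fun h => fcoef h (i + j)) fg0; apply/negP => /=.
have lt_i : (i < (i + j).+1)%N by rewrite ltnS leq_addr.
rewrite (bigD1 (Ordinal lt_i)) //= addKn big1 ?addr0 ?mulf_neq0 // => k.
rewrite -val_eqE /= neq_ltn => /orP[/fi -> | ik]; first by rewrite mul0r.
by rewrite gj ?mulr0 // ltn_subLR ?ltn_add2r // -ltnS.
Qed.

HB.instance Definition _ :=
  GRing.ComUnitRing_isIntegral.Build {fps A} fps_integral.

End IntegralDomain.

(* C[[X, Y]] is encoded as C[[Y]][[X]]; [coef2 f i j] is the coefficient of   *)
(* X^i Y^j. The same type also serves for C[[X^(1/m), Y^(1/m)]], the variables *)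
(* then standing for X^(1/m) and Y^(1/m), so that (i, j) is the exponent of    *)
(* X^(i/m) Y^(j/m); [puiseux_incl] below is the inclusion of the former ring   *)
(* in the latter.                                                              *)
Notation "{ 'fps2' C }" := {fps {fps C}} (at level 0, format "{ 'fps2'  C }").

Section BivariateSeries.
Variable C : idomainType.

Definition coef2 (f : {fps2 C}) (i j : nat) : C := fcoef (fcoef f i) j.
Definition fps2_of (c : nat -> nat -> C) : {fps2 C} :=
  Fps (fun i => Fps (c i)).

Definition fps2_const (c : C) : {fps2 C} :=
  fps2_of (fun i j => if (i == 0%N) && (j == 0%N) then c else 0).
Definition fps2_mono (a b : nat) : {fps2 C} :=
  fps2_of (fun i j => ((i == a) && (j == b))%:R).

(* f(X, Y) seen as the series f(U^m, V^m) in U = X^(1/m), V = Y^(1/m).         *)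
Definition puiseux_incl (m : nat) (f : {fps2 C}) : {fps2 C} :=
  fps2_of (fun i j =>
    if (m %| i)%N && (m %| j)%N then coef2 f (i %/ m) (j %/ m) else 0).

Definition exponents (zeta : {fps2 C}) : set (nat * nat) :=
  [set p | coef2 zeta p.1 p.2 != 0]%classic.

Definition hpart2 (d : nat) (f : {fps2 C}) : {fps2 C} :=
  fps2_of (fun i j => if (i + j == d)%N then coef2 f i j else 0).

End BivariateSeries.

(* The least n such that P n, or 0 if there is none.                           *)
Definition least (P : pred nat) : nat :=
  if pselect (exists n, P n) is left exP then ex_minn exP else 0%N.

Section Order.
Variable C : idomainType.

Definition order2 (f : {fps2 C}) : nat := least (fun d => hpart2 d f != 0).

Definition nu (m : nat) (zeta : {fps2 C}) : \bar rat :=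
  if zeta == 0 then +oo%E else ((order2 zeta)%:R / m%:R)%:E.

Definition initial_form (zeta : {fps2 C}) : {fps2 C} :=
  hpart2 (order2 zeta) zeta.

End Order.

Definition frac_map (A B : idomainType) (phi : A -> B) (x : {fraction A}) :
    {fraction B} :=
  tofrac (phi \n_(repr x)) / tofrac (phi \d_(repr x)).

Section FieldExtensions.
Variables (K L : fieldType) (iota : K -> L).

(* K(A), the smallest subfield of L containing the image of K and A.           *)
Definition adjoin (A : set L) : set L :=
  smallest [set P | divring_closed (in_set P)]%classic
           (range iota `|` A)%classic.

Definition is_minpoly (x : L) (p : {poly K}) : Prop :=
  [/\ p \is monic, root (map_poly iota p) x
    & forall q : {poly K}, q != 0 -> root (map_poly iota q) x ->
        (size p <= size q)%N].

End FieldExtensions.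

Section Puiseux.
Variable C : idomainType.
Local Notation R := {fps2 C}.
Local Notation S := {fps2 C}.

Definition puiseux_field_incl (m : nat) : {fraction R} -> {fraction S} :=
  frac_map (@puiseux_incl C m).

Definition minpoly_over_series (m : nat) (zeta : S) (F : {poly R}) : Prop :=
  is_minpoly (puiseux_field_incl m) (tofrac zeta) (map_poly (@tofrac R) F).

Definition privileged (m : nat) (zeta : S) (E : seq (nat * nat)) : Prop :=
  (forall p, p \in E -> exponents zeta p) /\
  adjoin (puiseux_field_incl m) [set tofrac zeta]%classic =
  adjoin (puiseux_field_incl m)
    [set tofrac (fps2_mono C p.1 p.2) | p in [set` E]]%classic.

Definition exponent_matrix (m : nat) (E : seq (nat * nat)) :
    'M[int]_(2, (size E).+2) :=
  \matrix_(r, c)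
    let p := nth (0, 0)%N [:: (m, 0%N), (0%N, m) & E] c in
    if r == ord0 then p.1%:Z else p.2%:Z.

Definition gcd_minors (k : nat) (M : 'M[int]_(2, k)) : nat :=
  \big[gcdn/0%N]_(u < k) \big[gcdn/0%N]_(v < k | (u < v)%N)
    `|\det (colsub (fun r : 'I_2 => if r == ord0 then u else v) M)|%N.

(* The value does not depend on the set of privileged exponents chosen.        *)
Definition puiseux_d (m : nat) (zeta : S) : nat :=
  gcd_minors
    (exponent_matrix m (xget [::] [set E | privileged m zeta E]%classic)).

End Puiseux.

Section TangentCone.
Variable C : fieldType.
Local Notation R := {fps2 C}.

Definition mnm3 (a b c : nat) : 'X_{1..3} :=
  [multinom nth 0%N [:: a; b; c] i | i < 3].

Definition hpart3 (d : nat) (F : {poly R}) : {mpoly C[3]} :=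
  \sum_(a < d.+1) \sum_(b < d.+1) \sum_(c < d.+1 | (a + b + c == d)%N)
    coef2 F`_c a b *: 'X_[mnm3 a b c].

(* Initial form of F(X, Y, Z), as a polynomial in X, Y, Z (variables 0, 1, 2). *)
Definition tangent_cone_eq (F : {poly R}) : {mpoly C[3]} :=
  hpart3 (least (fun d => hpart3 d F != 0)) F.

Definition mpoly_series (G : {mpoly C[3]}) : {poly R} :=
  mmap (fun c => (fps2_const c)%:P)
       (fun i : 'I_3 => [:: (fps2_mono C 1 0)%:P; (fps2_mono C 0 1)%:P; 'X]`_i) G.

Definition same_equation (T U : {mpoly C[3]}) : Prop :=
  exists2 c : C, c != 0 & T = c *: U.

Definition linear_form (l : {mpoly C[3]}) : Prop :=
  l != 0 /\ l \is 1.-homog.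

End TangentCone.

Definition irreducible_elt (D : unitRingType) (x : D) : Prop :=
  [/\ x != 0, x \isn't a GRing.unit
    & forall a b, x = a * b -> a \is a GRing.unit \/ b \is a GRing.unit].

(* Main.v *)
(* The group G = (Z/m)^2 acts on S by multiplying X^(1/m) and Y^(1/m) by m-th  *)
(* roots of unity, with ring of invariants R, so that F is the product of the  *)
(* Z - xi over the orbit of zeta. With nu(Z) = nu(zeta), the initial form of   *)
(* this product is the product of the Z - (initial form of xi); comparing with *)
(* the usual degree gives the three cases, the orbit of the initial form of    *)
(* zeta being covered uniformly when nu(zeta) = 1.                             *)
(* Finally d(zeta) is the order of the stabilizer of zeta: a set of privileged *)
(* exponents has the same stabilizer as zeta, hence generates with (mZ)^2 a    *)
(* lattice annihilated by the stabilizer, whose index is the gcd of the minors.*)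

From HB Require Import structures.
Require Import Defs.
From mathcomp Require Import all_boot all_order all_algebra all_solvable all_field generic_quotient.
From mathcomp Require Import mpoly.
From mathcomp Require Import boolp classical_sets constructive_ereal.
From mathcomp Require Import zify.

Set Implicit Arguments.
Unset Strict Implicit.
Unset Printing Implicit Defensive.

Import Order.TTheory GRing.Theory Num.Theory.

Local Open Scope ring_scope.

(** Fix a primitive [m]-th root of unity and let (Z/m)^2 act on S through [act]. A series fixed by
    the whole group has all its exponents in (mZ)^2, so it comes from R ([fixed_incl]); hence the
    product of the Z - y over the orbit of zeta descends to R, and it is the minimal polynomial F
    ([minpoly_over_seriesP]).

    Let N be the size of the orbit and w the order of zeta in units of 1/m. All conjugates have
    order w, so every monomial X^a Y^b Z^c of F satisfies m(a+b) + wc >= wN, and the terms with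
    equality come from the product of the Z - y with each y replaced by its part of degree w
    ([coef_prod_XsubC_order], [hpart2_coef_prod_XsubC]). It remains to compare this weight with the
    total degree a+b+c.

    If w > m, only Z^N survives in the lowest degree N ([tangent_cone_order_gt]). If w = m, weight
    and degree agree up to the factor m, and the cone is the product over the orbit of the initial
    forms. These run over the orbit of the initial form of zeta with constant multiplicity, the
    quotient of the orders of the two stabilizers ([prod_hpart2_orb], [tangent_cone_order_eq]);
    irreducibility comes from the equality of Z-degree and total degree ([minform_irreducible]). If
    w < m, only the constant coefficient of F contributes, so the cone is a binary form in X, Y,
    which splits over an algebraically closed field ([tangent_cone_order_lt]).

    The stabilizers are expressed by d in [puiseux_dE]: by Galois theory the stabilizer of zeta is
    the annihilator of its privileged exponents, and [card_annihilator] computes the order of the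
    latter as the gcd of the minors. *)

Section Coefficients.
Variable C : idomainType.
Implicit Types f g : {fps2 C}.

Lemma fps2P f g : (forall i j, coef2 f i j = coef2 g i j) -> f = g.
Proof. by move=> fg; apply: fpsP => i; apply: fpsP => j; apply: fg. Qed.

Lemma coef20 i j : coef2 (0 : {fps2 C}) i j = 0. Proof. by []. Qed.

Lemma coef21 i j : coef2 (1 : {fps2 C}) i j = ((i == 0%N) && (j == 0%N))%:R.
Proof. by rewrite /coef2 /=; case: eqP => //= _; rewrite mulrb. Qed.

Lemma coef2B f g i j : coef2 (f - g) i j = coef2 f i j - coef2 g i j.
Proof. by []. Qed.

Lemma fcoef_sum (A : zmodType) (I : Type) (r : seq I) (F : I -> {fps A}) j :
  fcoef (\sum_(k <- r) F k) j = \sum_(k <- r) fcoef (F k) j.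
Proof. by elim/big_rec2: _ => [|k x y _ <-]. Qed.

Lemma coef2M f g i j :
  coef2 (f * g) i j =
  \sum_(k < i.+1) \sum_(l < j.+1) coef2 f k l * coef2 g (i - k) (j - l).
Proof. by rewrite /coef2 /= fcoef_sum. Qed.

Lemma coef2_sum (I : Type) (r : seq I) (F : I -> {fps2 C}) i j :
  coef2 (\sum_(k <- r) F k) i j = \sum_(k <- r) coef2 (F k) i j.
Proof. by rewrite /coef2 !fcoef_sum. Qed.

End Coefficients.

Section ConstantsAndMonomials.
Variable C : idomainType.

Fact fps2_const_is_zmod_morphism : zmod_morphism (@fps2_const C).
Proof.
move=> a b; apply: fps2P => i j; rewrite /coef2 /=.
by case: ifP; rewrite ?subrr.
Qed.

Lemma coef2_constM (c : C) f i j :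
  coef2 (fps2_const c * f) i j = c * coef2 f i j.
Proof.
rewrite coef2M big_ord_recl big_ord_recl /= !subn0 /coef2 /=.
by rewrite !big1 ?addr0 // => k _; rewrite ?big1 ?mul0r // => l _; rewrite mul0r.
Qed.

Fact fps2_const_is_monoid_morphism : monoid_morphism (@fps2_const C).
Proof.
split=> [|a b]; apply: fps2P => i j.
  by rewrite coef21 /coef2 /=; case: ifP.
rewrite coef2_constM /coef2 /=; case: ifP => // _; exact/esym/mulr0.
Qed.

HB.instance Definition _ := GRing.isZmodMorphism.Build C {fps2 C}
  (@fps2_const C) fps2_const_is_zmod_morphism.
HB.instance Definition _ := GRing.isMonoidMorphism.Build C {fps2 C}
  (@fps2_const C) fps2_const_is_monoid_morphism.

Lemma fps2_monoM a b c d :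
  fps2_mono C a b * fps2_mono C c d = fps2_mono C (a + c) (b + d).
Proof.
apply: fps2P => i j; rewrite coef2M /coef2 /=.
have [/andP[ai bj]|] := boolP ((a <= i) && (b <= j))%N.
  rewrite (bigD1 (Ordinal (ai : (a < i.+1)%N))) //=.
  rewrite (bigD1 (Ordinal (bj : (b < j.+1)%N))) //= !eqxx mul1r.
  rewrite !big1 ?addr0 => [|k|l]; first by congr (_%:R); lia.
    move=> /eqP ka; rewrite big1 // => l _.
    by case: eqP => [ka'|]; rewrite ?mul0r //; case: ka; apply: val_inj.
  move=> /eqP lb; case: eqP => [lb'|]; rewrite ?andbF ?mul0r //.
  by case: lb; apply: val_inj.
move=> nab; rewrite big1 => [|k _]; first by rewrite (_ : _ && _ = false) //; lia.
rewrite big1 // => l _; case: eqP => [ka|]; case: eqP => [lb|] /=;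
  rewrite ?mul0r //.
by have := ltn_ord k; have := ltn_ord l; lia.
Qed.

Lemma fps2_mono1 : fps2_mono C 0 0 = 1.
Proof. by apply: fps2P => i j; rewrite coef21. Qed.

Lemma fps2_mono_exp a b k : fps2_mono C a b ^+ k = fps2_mono C (a * k) (b * k).
Proof.
elim: k => [|k IH]; first by rewrite !muln0 fps2_mono1.
by rewrite exprS IH fps2_monoM !mulnS.
Qed.

End ConstantsAndMonomials.

(** * Order and initial forms *)

Section Order.
Variable C : idomainType.
Implicit Types f g : {fps2 C}.

(** A lower bound rather than the order itself: 0 satisfies it for every [w], so vanishing
    coefficients and cancellations need no separate case. *)
Definition order_ge (w : nat) f :=
  forall i j, (i + j < w)%N -> coef2 f i j = 0.

Lemma coef2_hpart2 d f i j :
  coef2 (hpart2 d f) i j = if (i + j == d)%N then coef2 f i j else 0.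
Proof. by []. Qed.

Lemma hpart2B d f g : hpart2 d (f - g) = hpart2 d f - hpart2 d g.
Proof.
by apply: fps2P => i j; rewrite coef2B !coef2_hpart2; case: ifP; rewrite ?subrr.
Qed.

Lemma hpart20 d : hpart2 d (0 : {fps2 C}) = 0.
Proof. by apply: fps2P => i j; rewrite coef2_hpart2 if_same. Qed.

Lemma order_ge0 w : order_ge w 0. Proof. by []. Qed.

Lemma order_geB w f g : order_ge w f -> order_ge w g -> order_ge w (f - g).
Proof. by move=> hf hg i j ij; rewrite coef2B hf ?hg ?subrr. Qed.

Lemma order_geM d e f g :
  order_ge d f -> order_ge e g -> order_ge (d + e) (f * g).
Proof.
move=> hf hg i j ij; rewrite coef2M big1 // => k _; rewrite big1 // => l _.
have [kl|kl] := ltnP (k + l) d; first by rewrite hf ?mul0r.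
by rewrite hg ?mulr0 //; have := ltn_ord k; have := ltn_ord l; lia.
Qed.

(** In the convolution at total degree [d + e], a left degree below [d] kills the left factor and
    one above [d] forces a right degree below [e]. *)
Lemma hpart2M d e f g : order_ge d f -> order_ge e g ->
  hpart2 (d + e) (f * g) = hpart2 d f * hpart2 e g.
Proof.
move=> hf hg; apply: fps2P => i j; rewrite coef2_hpart2 !coef2M.
have [ij|ij] := eqVneq (i + j)%N (d + e)%N.
  apply: eq_bigr => k _; apply: eq_bigr => l _; rewrite !coef2_hpart2.
  have := ltn_ord k; have := ltn_ord l => hl hk.
  have [kl|kl|kl] := ltngtP (k + l)%N d.
  - by rewrite hf ?mul0r.
  - by rewrite mul0r hg ?mulr0 //; lia.
  - by rewrite ifT //; lia.
rewrite big1 // => k _; rewrite big1 // => l _; rewrite !coef2_hpart2.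
have := ltn_ord k; have := ltn_ord l => hl hk.
case: eqP => kl; last by rewrite mul0r.
by rewrite ifF ?mulr0 //; lia.
Qed.

Lemma hpart2_idem d f : hpart2 d (hpart2 d f) = hpart2 d f.
Proof. by apply: fps2P => i j; rewrite !coef2_hpart2; case: eqP. Qed.

Lemma order_ge_hpart2 d f : order_ge d (hpart2 d f).
Proof. by move=> i j ij; rewrite coef2_hpart2 ifF //; lia. Qed.

Lemma least_eq (P : pred nat) n :
  P n -> (forall d, (d < n)%N -> ~~ P d) -> least P = n.
Proof.
move=> Pn Plt; rewrite /least; case: pselect => [exP|[]]; last by exists n.
case: ex_minnP => k Pk kmin; apply/eqP; rewrite eqn_leq kmin //=.
by rewrite leqNgt; apply: contraL Pk => /Plt.
Qed.

Lemma hpart2_order2_neq0 f : f != 0 -> hpart2 (order2 f) f != 0.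
Proof.
move=> f0; rewrite /order2 /least; case: pselect => [exP|]; first by case: ex_minnP.
case; apply: contrapT => nex; case/eqP: f0; apply: fps2P => i j.
have : hpart2 (i + j) f = 0.
  by apply/eqP; apply: contrapT => /negP h; apply: nex; exists (i + j)%N.
by move=> /(congr1 (fun h => coef2 h i j)); rewrite coef2_hpart2 eqxx.
Qed.

Lemma order_ge_order2 f : f != 0 -> order_ge (order2 f) f.
Proof.
move=> f0 i j; rewrite /order2 /least; case: pselect => [exP|//].
case: ex_minnP => n _ nmin ij; apply/eqP; apply: contraLR ij => fij.
rewrite -leqNgt nmin //; apply: contraNneq fij.
by move=> /(congr1 (fun h => coef2 h i j)); rewrite coef2_hpart2 eqxx => ->.
Qed.

(* Give Z the weight w: then the product of the Z - xi is quasi-homogeneous up *)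
(* to terms of higher weight, its initial form being the product of the        *)
(* initial forms.                                                              *)
Lemma coef_prod_XsubC_order w (s : seq {fps2 C}) c :
  (forall x, x \in s -> order_ge w x) ->
  order_ge (w * (size s - c)) (\prod_(x <- s) ('X - x%:P))`_c.
Proof.
elim: s c => [|x s IH] c hs.
  rewrite big_nil coef1 muln0 => i j //.
have hx : order_ge w x by apply: hs; rewrite mem_head.
have {}IH c' : order_ge (w * (size s - c')) (\prod_(x <- s) ('X - x%:P))`_c'.
  by apply: IH => y ys; apply: hs; rewrite inE ys orbT.
rewrite big_cons mulrBl coefB coefXM coefCM.
have hxc : order_ge (w * (size s).+1 - w * c) (x * (\prod_(x <- s) ('X - x%:P))`_c).
  have [cs|cs] := leqP c (size s).
    by rewrite -mulnBr subSn // mulnS; apply: order_geM.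
  rewrite nth_default ?mulr0 //; last by rewrite size_prod_XsubC.
rewrite /= mulnBr; case: c hxc => [|c] hxc /=.
  by apply: order_geB.
by apply: order_geB => //; rewrite -mulnBr subSS.
Qed.

Lemma hpart2_coef_prod_XsubC w (s : seq {fps2 C}) c :
  (forall x, x \in s -> order_ge w x) -> (c <= size s)%N ->
  hpart2 (w * (size s - c)) (\prod_(x <- s) ('X - x%:P))`_c =
  (\prod_(x <- s) ('X - (hpart2 w x)%:P))`_c.
Proof.
elim: s c => [|x s IH] c hs cs.
  rewrite !big_nil muln0; apply: fps2P => i j; rewrite coef2_hpart2 coef1.
  by move: cs; rewrite leqn0 => /eqP->; rewrite coef21 addn_eq0; case: (_ && _).
have hx : order_ge w x by apply: hs; rewrite mem_head.
have hs' y : y \in s -> order_ge w y by move=> ys; apply: hs; rewrite inE ys orbT.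
rewrite !big_cons !mulrBl !coefB !coefXM !coefCM hpart2B; congr (_ - _).
  case: c cs => [|c] cs /=; first by rewrite hpart20.
  by rewrite subSS IH.
have [{}cs|{}cs] := leqP c (size s).
  by rewrite subSn // mulnS hpart2M ?IH //; apply: coef_prod_XsubC_order.
rewrite !nth_default ?mulr0 ?hpart20 ?size_prod_XsubC //.
Qed.

End Order.

(** * The inclusion of C[[X, Y]] into C[[X^(1/m), Y^(1/m)]] is an injective ring morphism *)

Section GradedSeries.
Variables (C : idomainType) (m : nat).
Hypothesis m_gt0 : (0 < m)%N.

Section OneVariable.
Variable A : comNzRingType.

(** Substitution of T^m for the variable T. Used once per variable it yields [puiseux_incl], whose
    multiplicativity is thereby reduced to one variable. *)
Definition fps_expand (f : {fps A}) : {fps A} :=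
  Fps (fun i => if (m %| i)%N then fcoef f (i %/ m) else 0).

Lemma fps_expandM : {morph fps_expand : f g / f * g}.
Proof.
move=> f g; apply: fpsP => i /=; case: ifP => mi; last first.
  rewrite big1 // => k _; case: ifP => mk; last by rewrite mul0r.
  by rewrite dvdn_subl ?mi ?mulr0 // -ltnS.
have [a ->] := dvdnP mi; rewrite mulnK //.
rewrite (bigID (fun k : 'I_(a * m).+1 => m %| k)%N) /= [X in _ = _ + X]big1 ?addr0; last first.
  by move=> k /negbTE->; rewrite mul0r.
have lt_a (k : 'I_a.+1) : (k * m < (a * m).+1)%N.
  by rewrite ltnS leq_mul2r -ltnS ltn_ord orbT.
have lt_i (k : 'I_(a * m).+1) : (k %/ m < a.+1)%N.
  by have := leq_div2r m (ltn_ord k : (k <= a * m)%N); rewrite mulnK.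
rewrite (reindex_onto (fun k : 'I_a.+1 => Ordinal (lt_a k))
   (fun k : 'I_(a * m).+1 => Ordinal (lt_i k))) /=; last first.
  by move=> k mk; apply: val_inj; rewrite /= divnK.
apply: eq_big => [k|k _].
  by rewrite -val_eqE /= mulnK // eqxx dvdn_mull.
by rewrite dvdn_mull // -mulnBl dvdn_mull // !mulnK.
Qed.

End OneVariable.

Lemma puiseux_inclE (f : {fps2 C}) :
  puiseux_incl m f = fps_expand (Fps (fun i => fps_expand (fcoef f i))).
Proof.
apply: fps2P => i j; rewrite /coef2 /=.
by case: (m %| i)%N.
Qed.

Fact puiseux_incl_is_zmod_morphism : zmod_morphism (@puiseux_incl C m).
Proof.
move=> f g; apply: fps2P => i j; rewrite coef2B /coef2 /=.
by case: ifP; rewrite ?subrr.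
Qed.

Fact puiseux_incl_is_monoid_morphism : monoid_morphism (@puiseux_incl C m).
Proof.
split=> [|f g].
  apply: fps2P => i j; rewrite coef21.
  transitivity (if (m %| i)%N && (m %| j)%N then coef2 (1 : {fps2 C}) (i %/ m) (j %/ m)
    else 0) => //; rewrite coef21.
  have div_eq0 k : (m %| k)%N -> (k %/ m == 0)%N = (k == 0)%N.
    by move=> /dvdnP[q ->]; rewrite mulnK // muln_eq0 -[m == 0%N]negbK -lt0n m_gt0 orbF.
  case: ifP => [/andP[mi mj]|]; first by rewrite !div_eq0.
  by case: i => [|i] //; case: j => [|j] //; rewrite !dvdn0.
rewrite !puiseux_inclE -fps_expandM; congr fps_expand; apply: fpsP => i /=.
transitivity (\sum_(k < i.+1) fps_expand (fcoef f k * fcoef g (i - k))).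
  apply: fpsP => j; rewrite fcoef_sum /=. case: ifP => mj.
    by rewrite fcoef_sum.
  by rewrite big1.
by apply: eq_bigr => k _; rewrite fps_expandM.
Qed.

End GradedSeries.

HB.instance Definition _ (C : idomainType) n :=
  GRing.isZmodMorphism.Build {fps2 C} {fps2 C} (@puiseux_incl C n.+1)
    (@puiseux_incl_is_zmod_morphism C n.+1).
HB.instance Definition _ (C : idomainType) n :=
  GRing.isMonoidMorphism.Build {fps2 C} {fps2 C} (@puiseux_incl C n.+1)
    (@puiseux_incl_is_monoid_morphism C n.+1 (ltn0Sn n)).

Section Contraction.
Variable C : idomainType.

(** Reads only the exponents in (mZ)^2: a left inverse of the inclusion on all series, and a
    two-sided one on the invariants of the group. *)
Definition contract (m : nat) (f : {fps2 C}) : {fps2 C} :=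
  fps2_of (fun i j => coef2 f (m * i) (m * j)).

Lemma coef2_puiseux_incl m (f : {fps2 C}) i j : (0 < m)%N ->
  coef2 (puiseux_incl m f) (m * i) (m * j) = coef2 f i j.
Proof. by move=> m_gt0; rewrite [LHS]/coef2 /= !dvdn_mulr //= !mulKn. Qed.

Lemma puiseux_inclK m : (0 < m)%N -> cancel (@puiseux_incl C m) (contract m).
Proof. by move=> m_gt0 f; apply: fps2P => i j; apply: coef2_puiseux_incl. Qed.

Lemma contractK m (f : {fps2 C}) :
  (forall i j, exponents f (i, j) -> (m %| i)%N && (m %| j)%N) ->
  puiseux_incl m (contract m f) = f.
Proof.
move=> fP; apply: fps2P => i j; rewrite [LHS]/coef2 /=.
case: ifP => [/andP[mi mj]|/negP nmij]; last first.
  by apply/esym/eqP; apply: contrapT => /negP /fP.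
by rewrite /coef2 /= !(mulnC m) !divnK.
Qed.

End Contraction.
(** * Index of a sublattice of Z^2 *)

Section LatticeIndex.
Variables (m : nat) (E : seq (nat * nat)).
Hypothesis m_gt0 : (0 < m)%N.

Local Notation gens := [:: (m, 0%N), (0%N, m) & E].

(** The subgroup of Z^2 generated by the columns of the exponent matrix; closure under subtraction
    is enough, since there is at least one generator. *)
Inductive lattice : int -> int -> Prop :=
| lattice_gen p : p \in gens -> lattice p.1%:Z p.2%:Z
| lattice_sub x y x' y' : lattice x y -> lattice x' y' ->
    lattice (x - x') (y - y').

Lemma lattice00 : lattice 0 0.
Proof.
have h : lattice m%:Z 0 by apply: (@lattice_gen (m, 0%N)); rewrite mem_head.
by have := lattice_sub h h; rewrite !subrr.
Qed.

Lemma lattice_opp x y : lattice x y -> lattice (- x) (- y).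
Proof. by move/(lattice_sub lattice00); rewrite !sub0r. Qed.

Lemma lattice_add x y x' y' :
  lattice x y -> lattice x' y' -> lattice (x + x') (y + y').
Proof. by move=> h /lattice_opp /(lattice_sub h); rewrite !opprK. Qed.

Lemma lattice_scale (k : int) x y : lattice x y -> lattice (k * x) (k * y).
Proof.
move=> h; case: (intP k) => [|n|n]; first by rewrite !mul0r; apply: lattice00.
  elim: n.+1 => [|n' IH]; first by rewrite !mul0r; apply: lattice00.
  by rewrite -addn1 PoszD !mulrDl !mul1r; apply: lattice_add.
rewrite !mulNr; apply: lattice_opp.
elim: n.+1 => [|n' IH]; first by rewrite !mul0r; apply: lattice00.
by rewrite -addn1 PoszD !mulrDl !mul1r; apply: lattice_add.
Qed.

(** Euclidean division by the least positive element of [H]. *)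
Lemma subgroup_generator (H : int -> Prop) (k : nat) :
    (forall x y, H x -> H y -> H (x - y)) -> (forall a x, H x -> H (a * x)) ->
    (0 < k)%N -> H k%:Z ->
  exists p : nat, [/\ (0 < p)%N, H p%:Z & forall x, H x -> (p %| x)%Z].
Proof.
move=> HB HZ k0 Hk.
have exP : exists p, (0 < p)%N && `[< H p%:Z >].
  by exists k; rewrite k0; apply/asboolP.
case: (ex_minnP exP) => p /andP[p0 /asboolP Hp] pmin; exists p; split=> // x Hx.
have Hr : H (x %% p)%Z by rewrite /modz; apply: HB => //; apply: HZ.
have : (0 <= (x %% p)%Z)%R by rewrite modz_ge0 // eqz_nat -lt0n.
have : ((x %% p)%Z < p%:Z)%R by rewrite ltz_pmod // ltz_nat.
case xr: (x %% p)%Z Hr => [r|//] Hr; rewrite ltz_nat => rp _.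
case: r => [|r] in Hr xr rp; first by rewrite /dvdz; apply/dvdz_mod0P.
have := pmin r.+1; rewrite /= asboolT // => /(_ isT).
by rewrite leqNgt rp.
Qed.

(** Hermite normal form: [p] generates the projection to the first coordinate, [r] the kernel of
    that projection, and (p, q), (0, r) form a basis. *)
Lemma lattice_basis : exists (p r : nat) (q : int),
  [/\ (0 < p)%N, (0 < r)%N, lattice p%:Z q, lattice 0 r%:Z &
   forall x y, lattice x y -> exists a b : int, x = a * p%:Z /\ y = a * q + b * r%:Z].
Proof.
have [p [p0 [q Hpq] pdvd]] : exists p : nat,
    [/\ (0 < p)%N, exists q, lattice p%:Z q
      & forall x, (exists y, lattice x y) -> (p %| x)%Z].
  apply: (@subgroup_generator (fun x => exists y, lattice x y) m) => //.
  - by move=> x x' [y h] [y' h']; exists (y - y'); apply: lattice_sub.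
  - by move=> a x [y h]; exists (a * y); apply: lattice_scale.
  - by exists 0; apply: (@lattice_gen (m, 0%N)); rewrite mem_head.
have [r [r0 Hr rdvd]] : exists p : nat,
    [/\ (0 < p)%N, lattice 0 p%:Z & forall x, lattice 0 x -> (p %| x)%Z].
  apply: (@subgroup_generator (lattice 0) m) => //.
  - by move=> x x' h /(lattice_sub h); rewrite subrr.
  - by move=> a x /(lattice_scale a); rewrite mulr0.
  - by apply: (@lattice_gen (0%N, m)); rewrite !inE eqxx orbT.
exists p, r, q; split=> // x y h.
have /dvdzP[a xa] : (p %| x)%Z by apply: pdvd; exists y.
have : lattice 0 (y - a * q).
  by have := lattice_sub h (lattice_scale a Hpq); rewrite xa subrr.
by move/rdvd/dvdzP => [b yb]; exists a, b; rewrite -yb; split=> //; rewrite addrC subrK.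
Qed.

(** The characters of (Z/m)^2 trivial on the lattice. Testing them on [E] suffices, as (m, 0) and
    (0, m) always pair to multiples of [m]. *)
Definition annihilator : {set 'I_m * 'I_m} :=
  [set g : 'I_m * 'I_m | all (fun p : nat * nat => m %| g.1 * p.1 + g.2 * p.2)%N E].

Lemma annihilatorP (g : 'I_m * 'I_m) :
  reflect (forall x y, lattice x y -> (m %| g.1%:Z * x + g.2%:Z * y)%Z)
          (g \in annihilator).
Proof.
rewrite inE; apply: (iffP allP) => [h x y|h p pE]; last first.
  have /h : lattice p.1 p.2 by apply: lattice_gen; rewrite !inE pE !orbT.
  by rewrite -!PoszM -PoszD.
elim=> [p|x1 y1 x2 y2 _ h1 _ h2]; last first.
  have := rpredB h1 h2; congr (_ %| _)%Z; lia.
rewrite -!PoszM -PoszD !inE => /or3P[/eqP->|/eqP->|/h //] /=.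
  by rewrite dvdzE /= muln0 addn0 dvdn_mull.
by rewrite dvdzE /= muln0 add0n dvdn_mull.
Qed.

Lemma card_linear_congruence (p : nat) (c : int) :
  (0 < p)%N -> (p %| m)%N -> (p %| c)%Z ->
  #|[set a : 'I_m | (m %| p%:Z * a%:Z + c)%Z]| = p.
Proof.
move=> p0 /dvdnP[k mk] /dvdzP[c' cc'].
have k0 : (0 < k)%N by move: m_gt0; rewrite mk muln_gt0 => /andP[].
(* After division by [p] the congruence reads a = - c' modulo k = m/p; [t] is its least solution,
   and the others below [m] are the t + k s with s < p. *)
pose t := `|(- c' %% k)%Z|%N.
have tE : t%:Z = (- c' %% k)%Z by rewrite gez0_abs // modz_ge0 // eqz_nat -lt0n.
have tk : (t < k)%N by rewrite -ltz_nat tE ltz_pmod // ltz_nat.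
have lt_m (s : 'I_p) : (t + k * s < m)%N.
  by rewrite mk; have := ltn_ord s; nia.
rewrite -[RHS](card_ord p) -cardsT.
rewrite -(card_imset _ (_ : injective (fun s : 'I_p => Ordinal (lt_m s)))); last first.
  move=> s s' /(congr1 val) /= /eqP; rewrite eqn_add2l eqn_pmul2l // => /eqP ss'.
  exact: val_inj.
congr #|pred_of_set _|; apply/setP => a; rewrite inE cc'.
have -> : m%:Z = k%:Z * p%:Z by rewrite {1}mk PoszM.
have -> : p%:Z * a%:Z + c' * p%:Z = (a%:Z - - c') * p%:Z by lia.
rewrite dvdz_mul2r ?eqz_nat -?lt0n // -eqz_mod_dvd -tE.
apply/idP/imsetP => [|[s _ ->]] /=; last first.
  by rewrite PoszD PoszM mulrC addrC modzMDl tE modz_mod.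
move=> /eqP at_; have lt_p : (a %/ k < p)%N by rewrite ltn_divLR // mulnC -mk.
exists (Ordinal lt_p) => //; apply: val_inj => /=.
rewrite {1}(divn_eq a k) addnC mulnC; congr (_ + _)%N.
by apply/eqP; rewrite -eqz_nat -modz_nat at_.
Qed.

(** The system is triangular: pairing with (0, r) leaves [r] values for the second coordinate, and
    for each of them pairing with (p, q) leaves [p] values for the first. *)
Lemma card_annihilator_basis (p r : nat) (q : int) :
    (0 < p)%N -> (0 < r)%N -> lattice p%:Z q -> lattice 0 r%:Z ->
    (forall x y, lattice x y ->
       exists a b : int, x = a * p%:Z /\ y = a * q + b * r%:Z) ->
  #|annihilator| = (p * r)%N.
Proof.
move=> p0 r0 Hpq Hr basis.
have [a1 [b1 [ma1 /esym/eqP]]] : exists a b : int, m%:Z = a * p%:Z /\ 0 = a * q + b * r%:Z.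
  by apply: basis; apply: (@lattice_gen (m, 0%N)); rewrite mem_head.
rewrite addr_eq0 => /eqP aqbr.
have [a2 [b2 [/esym/eqP a2p]]] : exists a b : int, 0 = a * p%:Z /\ m%:Z = a * q + b * r%:Z.
  by apply: basis; apply: (@lattice_gen (0%N, m)); rewrite !inE eqxx orbT.
move: a2p; rewrite mulf_eq0 eqz_nat [p == 0%N]eqn0Ngt p0 orbF => /eqP-> {a2}.
rewrite mul0r add0r => mb2.
have pm : (p %| m)%N by have : (p %| m%:Z)%Z by rewrite ma1 dvdz_mull.
have rm : (r %| m)%N by have : (r %| m%:Z)%Z by rewrite mb2 dvdz_mull.
(* Solvability of the second congruence. Since m = a1 p = b2 r and a1 q = - b1 r, writing b = t b2
   gives r b q = t q a1 p = - t b1 r p, and [r] cancels. *)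
have pbq (b : nat) : (m %| r%:Z * b%:Z + 0)%Z -> (p %| b%:Z * q)%Z.
  rewrite addr0 mb2 mulrC dvdz_mul2r ?eqz_nat -?lt0n // => /dvdzP[t ->].
  apply/dvdzP; exists (- t * b1).
  have r_neq0 : r%:Z != 0 by rewrite eqz_nat -lt0n.
  have p_neq0 : p%:Z != 0 by rewrite eqz_nat -lt0n.
  have e1 : a1 * p%:Z = b2 * r%:Z by rewrite -ma1.
  apply: (mulIf r_neq0).
  transitivity (t * q * (b2 * r%:Z)); first by lia.
  rewrite -e1; transitivity (t * p%:Z * (a1 * q)); first by lia.
  by rewrite aqbr; lia.
rewrite -sum1_card (eq_bigl (fun g : 'I_m * 'I_m =>
    (m %| r%:Z * g.2%:Z + 0)%Z && (m %| p%:Z * g.1%:Z + g.2%:Z * q)%Z)); last first.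
  move=> g; apply/annihilatorP/andP => [h|[h1 h2] x y /basis[a [b [-> ->]]]].
    split; first by have := h _ _ Hr; congr (_ %| _)%Z; lia.
    by have := h _ _ Hpq; congr (_ %| _)%Z; lia.
  have := rpredD (dvdz_mull b h1) (dvdz_mull a h2); congr (_ %| _)%Z; lia.
rewrite (eq_bigl (fun g : 'I_m * 'I_m =>
   xpredT g.1 && ((m %| r%:Z * g.2%:Z + 0)%Z && (m %| p%:Z * g.1%:Z + g.2%:Z * q)%Z))) //.
rewrite -(pair_big_dep xpredT (fun i j : 'I_m =>
   (m %| r%:Z * j%:Z + 0)%Z && (m %| p%:Z * i%:Z + j%:Z * q)%Z) (fun _ _ => 1%N)) /=.
rewrite (exchange_big_dep (fun j : 'I_m => (m %| r%:Z * j%:Z + 0)%Z)) /=; last first.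
  by move=> i j _ /andP[].
rewrite (eq_bigr (fun _ => p)) => [|j hj].
  rewrite sum_nat_const mulnC -[in RHS](@card_linear_congruence r 0) //.
  by congr (_ * _)%N; apply: eq_card => j; rewrite inE.
rewrite sum1dep_card -[RHS](@card_linear_congruence p (j%:Z * q)) //; last exact: pbq.
by congr #|pred_of_set _|; apply/setP => i; rewrite !inE hj.
Qed.

Lemma det_mx22 (R : comNzRingType) (M : 'M[R]_2) :
  \det M = M ord0 ord0 * M ord_max ord_max - M ord0 ord_max * M ord_max ord0.
Proof.
rewrite (expand_det_row _ ord0) !big_ord_recl big_ord0 /cofactor !det_mx11 !mxE /=.
rewrite addr0 expr0 mul1r expr1 mulN1r mulrN.
by congr (_ * M _ _ - M _ _ * M _ _); apply: val_inj.
Qed.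

Lemma det_colsub_exponent_matrix (u v : 'I_(size E).+2) :
  \det (colsub (fun r : 'I_2 => if r == ord0 then u else v) (exponent_matrix m E)) =
  (nth (0, 0)%N gens u).1%:Z * (nth (0, 0)%N gens v).2%:Z
  - (nth (0, 0)%N gens v).1%:Z * (nth (0, 0)%N gens u).2%:Z.
Proof. by rewrite det_mx22 !mxE. Qed.

(** Both numbers equal [p * r]. Each minor is a multiple of the determinant p r of the basis;
    conversely the gcd divides the determinant of any two lattice vectors, in particular p r. *)
Lemma card_annihilator : #|annihilator| = gcd_minors (exponent_matrix m E).
Proof.
have [p [r [q [p0 r0 Hpq Hr basis]]]] := lattice_basis.
rewrite (card_annihilator_basis p0 r0 Hpq Hr basis).
have gensP (u : 'I_(size E).+2) :
    lattice (nth (0, 0)%N gens u).1%:Z (nth (0, 0)%N gens u).2%:Z.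
  by apply: lattice_gen; apply: mem_nth; apply: ltn_ord.
set g := gcd_minors _; apply/eqP; rewrite eqn_dvd; apply/andP; split.
  apply/dvdn_biggcdP => u _; apply/dvdn_biggcdP => v _.
  rewrite det_colsub_exponent_matrix.
  have [a [b [-> ->]]] := basis _ _ (gensP u).
  have [a' [b' [-> ->]]] := basis _ _ (gensP v).
  rewrite -[(p * r)%N]/`|(p * r)%N : int|%N -dvdzE PoszM.
  by apply/dvdzP; exists (a * b' - a' * b); lia.
(* By bilinearity it is enough to treat two generators; [gcd_minors] only covers the columns u < v,
   the other cases following by antisymmetry. *)
have minor x y x' y' : lattice x y -> lattice x' y' -> (g %| x * y' - x' * y)%Z.
  move=> h; elim=> [p' p'E|x1 y1 x2 y2 _ h1 _ h2]; last first.
    by have := rpredB h1 h2; congr (_ %| _)%Z; lia.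
  elim: h => {x y} [p1 p1E|x1 y1 x2 y2 _ h1 _ h2]; last first.
    by have := rpredB h1 h2; congr (_ %| _)%Z; lia.
  have lt1 : (index p1 gens < (size E).+2)%N by rewrite -[_.+2]/(size gens) index_mem.
  have lt2 : (index p' gens < (size E).+2)%N by rewrite -[_.+2]/(size gens) index_mem.
  have key (u v : 'I_(size E).+2) : (u < v)%N ->
     (g %| (nth (0, 0)%N gens u).1%:Z * (nth (0, 0)%N gens v).2%:Z
  - (nth (0, 0)%N gens v).1%:Z * (nth (0, 0)%N gens u).2%:Z)%Z.
    move=> uv; rewrite -det_colsub_exponent_matrix dvdzE /=.
    by apply: (@biggcdn_inf _ u) => //; apply: (@biggcdn_inf _ v).
  have e1 : nth (0, 0)%N gens (Ordinal lt1) = p1 by rewrite nth_index.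
  have e2 : nth (0, 0)%N gens (Ordinal lt2) = p' by rewrite nth_index.
  rewrite -e1 -e2.
  have [/key //|/key h|/val_inj ->] := ltngtP (Ordinal lt1 : nat) (Ordinal lt2).
    by rewrite -rpredN opprB.
  by rewrite subrr dvdz0.
have := minor _ _ _ _ Hpq Hr; rewrite mul0r subr0 -PoszM => h; exact: h.
Qed.

End LatticeIndex.
(** * Series and polynomials in X, Y, Z *)

Section TangentCones.
Variable C : fieldType.
Local Notation R := {fps2 C}.

Lemma mnm3_eta (k : 'X_{1..3}) : exists a b c, k = mnm3 a b c.
Proof.
exists (k ord0), (k (lift ord0 ord0)), (k ord_max); apply/mnmP => i.
rewrite mnmE; case: i => [[|[|[|//]]] lti] /=; congr (k _); exact: val_inj.
Qed.

Lemma mnm3_inj a b c a' b' c' :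
  (mnm3 a b c == mnm3 a' b' c') = [&& a == a', b == b' & c == c'].
Proof.
apply/eqP/and3P => [/mnmP h|[/eqP-> /eqP-> /eqP->] //].
have := h ord0; have := h (lift ord0 ord0); have := h ord_max.
by rewrite !mnmE /= => -> -> ->.
Qed.

Lemma mdeg_mnm3 a b c : mdeg (mnm3 a b c) = (a + b + c)%N.
Proof. by rewrite mdegE !big_ord_recl big_ord0 !mnmE /= addn0 addnA. Qed.

Lemma mcoeff_hpart3 d (F : {poly R}) a b c :
  (hpart3 d F)@_(mnm3 a b c) = if (a + b + c == d)%N then coef2 F`_c a b else 0.
Proof.
rewrite /hpart3 raddf_sum /=; under eq_bigr do rewrite raddf_sum /=.
under eq_bigr do under eq_bigr do rewrite raddf_sum /=.
case: eqP => [abcd|nabcd]; last first.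
  do 2!(rewrite big1 // => ? _); rewrite big1 // => k /eqP hk.
  rewrite mcoeffZ mcoeffX mnm3_inj; case: and3P => [[/eqP ea /eqP eb /eqP ec]|].
    by move: nabcd hk; rewrite ea eb ec.
  by rewrite mulr0.
have la : (a < d.+1)%N by lia.
have lb : (b < d.+1)%N by lia.
have lc : (c < d.+1)%N by lia.
rewrite (bigD1 (Ordinal la)) //= (bigD1 (Ordinal lb)) //=.
rewrite (bigD1 (Ordinal lc)) /= ?abcd // mcoeffZ mcoeffX eqxx mulr1.
have off (k : 'I_d.+1) n (h : (n < d.+1)%N) : k != Ordinal h -> (k == n :> nat) = false.
  by rewrite -val_eqE => /negbTE.
rewrite !big1 ?addr0 // => [k /off e|k /off e|k /andP[_ /off e]].
- rewrite big1 // => k' _; rewrite big1 // => k'' _.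
  by rewrite mcoeffZ mcoeffX mnm3_inj e mulr0.
- by rewrite big1 // => k' _; rewrite mcoeffZ mcoeffX mnm3_inj e andbF mulr0.
- by rewrite mcoeffZ mcoeffX mnm3_inj e !andbF mulr0.
Qed.

Lemma coef2_mpoly_series (G : {mpoly C[3]}) a b c :
  coef2 (mpoly_series G)`_c a b = G@_(mnm3 a b c).
Proof.
rewrite /mpoly_series /mmap coef_sum coef2_sum [in RHS](mpolyE G) raddf_sum /=.
apply: eq_bigr => k _; rewrite mcoeffZ mcoeffX.
have [a' [b' [c' ->]]] := mnm3_eta k.
rewrite coefCM coef2_constM; congr (_ * _).
rewrite /mmap1 !big_ord_recl big_ord0 mulr1 !mnmE /= -!rmorphXn /=.
rewrite !fps2_mono_exp !mul1n !mul0n mulrA -rmorphM /= fps2_monoM add0n addn0.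
rewrite coefCM coefXn mnm3_inj.
case: (c =P c') => [->|nc]; last first.
  by rewrite mulr0 coef20 [c' == c]eq_sym (introF eqP nc) !andbF.
by rewrite eqxx andbT mulr1 /coef2 /= [a == a']eq_sym [b == b']eq_sym.
Qed.

Lemma mpoly_series_inj : injective (@mpoly_series C).
Proof.
move=> G H GH; apply/mpolyP => k; have [a [b [c ->]]] := mnm3_eta k.
by rewrite -!coef2_mpoly_series GH.
Qed.

Lemma mpoly_seriesM : {morph @mpoly_series C : G H / G * H}.
Proof. exact: (mmap_is_multiplicative _ (polyC \o @fps2_const C)).1. Qed.

Lemma mpoly_series1 : mpoly_series (1 : {mpoly C[3]}) = 1.
Proof. exact: (mmap_is_multiplicative _ (polyC \o @fps2_const C)).2. Qed.

Lemma mpoly_seriesXn (G : {mpoly C[3]}) e : mpoly_series (G ^+ e) = mpoly_series G ^+ e.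
Proof.
elim: e => [|e IH]; first by rewrite !expr0 mpoly_series1.
by rewrite !exprS mpoly_seriesM IH.
Qed.

Lemma mpoly_series_size (G : {mpoly C[3]}) : (size (mpoly_series G) <= msize G)%N.
Proof.
apply/leq_sizeP => c Gc; apply: fps2P => a b; rewrite coef2_mpoly_series.
apply: memN_msupp_eq0; apply: msize_mdeg_ge; rewrite mdeg_mnm3.
by rewrite (leq_trans Gc) // leq_addl.
Qed.

Lemma msize_hpart3 d (F : {poly R}) : (msize (hpart3 d F) <= d.+1)%N.
Proof.
rewrite msizeE; apply/bigmax_leqP_seq => k kF _; move: kF.
have [a [b [c ->]]] := mnm3_eta k.
by rewrite mcoeff_msupp mcoeff_hpart3 mdeg_mnm3; case: (_ =P d) => [->|]; rewrite ?eqxx.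
Qed.

Lemma tangent_cone_eqE d (F : {poly R}) :
    hpart3 d F != 0 ->
    (forall a b c, (a + b + c < d)%N -> coef2 F`_c a b = 0) ->
  tangent_cone_eq F = hpart3 d F.
Proof.
move=> Fd Flt; rewrite /tangent_cone_eq (@least_eq _ d) // => e ed.
rewrite negbK; apply/eqP/mpolyP => k; have [a [b [c ->]]] := mnm3_eta k.
by rewrite mcoeff0 mcoeff_hpart3; case: eqP => // abce; rewrite Flt // abce.
Qed.

Lemma same_equation_refl (T : {mpoly C[3]}) : same_equation T T.
Proof. by exists 1; rewrite ?oner_eq0 // scale1r. Qed.

End TangentCones.

(** * Binary forms in X, Y split into linear forms *)

Section BinaryForms.
Variable C : closedFieldType.

(** This is Y^N p(X/Y). The degree [N] may exceed that of [p]: each missing root is a root at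
    infinity and gives a factor Y. *)
Definition homogenize (N : nat) (p : {poly C}) : {mpoly C[3]} :=
  \sum_(a < N.+1) p`_a *: 'X_[mnm3 a (N - a) 0].

Lemma mcoeff_homogenize N (p : {poly C}) a b c :
  (homogenize N p)@_(mnm3 a b c) = if (a + b == N)%N && (c == 0)%N then p`_a else 0.
Proof.
rewrite /homogenize raddf_sum /=; case: ifP => [/andP[/eqP abN /eqP c0]|h].
  have la : (a < N.+1)%N by lia.
  rewrite (bigD1 (Ordinal la)) //= mcoeffZ mcoeffX mnm3_inj.
  rewrite eqxx (_ : _ && _ = true) ?mulr1; last by rewrite c0 eqxx -abN addKn eqxx.
  rewrite big1 ?addr0 // => k; rewrite -val_eqE /= => /negbTE e.
  by rewrite mcoeffZ mcoeffX mnm3_inj e mulr0.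
rewrite big1 // => k _; rewrite mcoeffZ mcoeffX mnm3_inj.
case: and3P => [[/eqP ea /eqP eb /eqP ec]|]; last by rewrite mulr0.
by have := ltn_ord k; move: h; rewrite -ea -eb -ec eqxx andbT; lia.
Qed.

Definition linear_factor (r : C) : {mpoly C[3]} :=
  'X_[mnm3 1 0 0] - r *: 'X_[mnm3 0 1 0].

Lemma linear_form_neq0 (l : {mpoly C[3]}) a b c :
  l@_(mnm3 a b c) != 0 -> l \is 1.-homog -> linear_form l.
Proof.
by move=> h hl; split=> //; apply: contraNneq h => ->; rewrite mcoeff0.
Qed.

Lemma linear_form_factor r : linear_form (linear_factor r).
Proof.
apply: (@linear_form_neq0 _ 1 0 0).
  by rewrite mcoeffB mcoeffZ !mcoeffX !mnm3_inj /= mulr0 subr0 oner_eq0.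
by apply: rpredB; rewrite ?rpredZ // dhomogX /= mdeg_mnm3.
Qed.

Lemma linear_form_Y : linear_form ('X_[mnm3 0 1 0] : {mpoly C[3]}).
Proof.
apply: (@linear_form_neq0 _ 0 1 0); last by rewrite dhomogX /= mdeg_mnm3.
by rewrite mcoeffX eqxx oner_eq0.
Qed.

Lemma mnm3D a b c a' b' c' :
  (mnm3 a b c + mnm3 a' b' c')%MM = mnm3 (a + a') (b + b') (c + c').
Proof.
apply/mnmP => i; rewrite mnmDE !mnmE.
by case: i => [[|[|[|//]]] lti].
Qed.

Lemma homogenizeM N (p : {poly C}) r : (size p <= N.+1)%N ->
  homogenize N.+1 (('X - r%:P) * p) = linear_factor r * homogenize N p.
Proof.
move=> pN; rewrite /homogenize mulr_sumr.
under [RHS]eq_bigr do rewrite mulrBl -!scalerAl -!scalerAr -!mpolyXD !mnm3D.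
rewrite sumrB.
under [LHS]eq_bigr do rewrite mulrBl coefB coefXM coefCM scalerBl.
rewrite sumrB; congr (_ - _).
  rewrite big_ord_recl /= scale0r add0r; apply: eq_bigr => a _.
  by rewrite /= add1n subSS.
rewrite big_ord_recr /= nth_default // mulr0 scale0r addr0; apply: eq_bigr => a _.
by rewrite scalerA add0n addn0 add1n subSn // -ltnS.
Qed.

Lemma homogenizeZ N c (p : {poly C}) : homogenize N (c *: p) = c *: homogenize N p.
Proof.
by rewrite /homogenize scaler_sumr; apply: eq_bigr => a _; rewrite coefZ scalerA.
Qed.

Lemma homogenize_prod N (s : seq C) : (size s <= N)%N ->
  homogenize N (\prod_(r <- s) ('X - r%:P)) =
  \prod_(l <- nseq (N - size s) 'X_[mnm3 0 1 0] ++ map linear_factor s) l.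
Proof.
rewrite big_cat /= big_map; elim: s N => [|r s IH] N /=.
  rewrite !big_nil mulr1 subn0 => _.
  rewrite big_nseq /= -[iter _ _ _]/(iter N _ _).
  have -> : iter N ( *%R 'X_[mnm3 0 1 0]) 1 = 'X_[mnm3 0 1 0] ^+ N :> {mpoly C[3]}.
    by elim: N => [|N IH] //=; rewrite IH exprS.
  apply/mpolyP => k; have [a [b [c ->]]] := mnm3_eta k.
  rewrite mcoeff_homogenize mcoeffXn coef1.
  have -> : (mnm3 0 1 0 *+ N)%MM = mnm3 0 N 0.
    by apply/mnmP => i; rewrite mulmnE !mnmE; case: i => [[|[|[|//]]] ?] /=; lia.
  rewrite mnm3_inj; case: a => [|a]; last by rewrite if_same.
  by rewrite /= [N == b]eq_sym [0%N == c]eq_sym; case: (_ && _).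
case: N => // N sN; rewrite !big_cons homogenizeM ?IH ?size_prod_XsubC //.
by rewrite subSS mulrCA.
Qed.

Lemma homogenize_split N (p : {poly C}) : (size p <= N.+1)%N -> p != 0 ->
  exists2 s : seq {mpoly C[3]}, (forall l, l \in s -> linear_form l) &
    same_equation (homogenize N p) (\prod_(l <- s) l).
Proof.
move=> pN p0; have [s ps] := closed_field_poly_normal p.
exists (nseq (N - size s) 'X_[mnm3 0 1 0] ++ map linear_factor s).
  move=> l; rewrite mem_cat => /orP[|/mapP[r _ ->]]; last exact: linear_form_factor.
  by move=> /nseqP[-> _]; exact: linear_form_Y.
exists (lead_coef p); first by rewrite lead_coef_eq0.
rewrite {1}ps homogenizeZ homogenize_prod //.
by move: pN; rewrite ps size_scale ?lead_coef_eq0 // size_prod_XsubC.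
Qed.

End BinaryForms.
(** * Fraction fields and adjunction *)

Section FractionMaps.
Variables (A B : idomainType) (phi : {rmorphism A -> B}).
Hypothesis phi_inj : injective phi.
Local Notation "x %:F" := (@tofrac _ x).

(** [frac_map] is defined on a chosen representative; this identity relates that representative to a
    genuine quotient. *)
Lemma fraction_repr (D : idomainType) (x : {fraction D}) :
  x = (\n_(repr x))%:F / (\d_(repr x))%:F.
Proof.
rewrite -[LHS]reprK -[in LHS](Ratio_numden (repr x)).
move: (denom_ratioP (repr x)); set n := \n_(repr x); set d := \d_(repr x) => d0.
have dF0 : d%:F != 0 by rewrite tofrac_eq0.
apply: (mulIf dF0); rewrite divfK //; unlock tofrac.
rewrite -[LHS](FracField.pi_mul (Ratio n d) (Ratio d 1)).
apply/eqP; rewrite FracField.equivf_def /FracField.mulf.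
by rewrite !numden_Ratio ?mulf_neq0 ?oner_eq0 // !mulr1 mulrC.
Qed.

Lemma fractionP (D : idomainType) (x : {fraction D}) :
  exists n d : D, d != 0 /\ x = n%:F / d%:F.
Proof.
exists (\n_(repr x)), (\d_(repr x)); split; first exact: denom_ratioP.
exact: fraction_repr.
Qed.

Lemma frac_map_div (n d : A) : d != 0 ->
  frac_map phi (n%:F / d%:F) = (phi n)%:F / (phi d)%:F.
Proof.
move=> d0; rewrite /frac_map; set x := n%:F / d%:F.
have xE := fraction_repr x.
have dr0 := denom_ratioP (repr x).
have phi_neq0 (a : A) : a != 0 -> (phi a)%:F != 0.
  by rewrite tofrac_eq0 -(rmorph0 phi) (inj_eq phi_inj).
have dF0 (a : A) : a != 0 -> a%:F != 0 by rewrite tofrac_eq0.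
apply/eqP; rewrite eqr_div ?phi_neq0 // -!rmorphM tofrac_eq -?rmorphM (inj_eq phi_inj).
by rewrite -tofrac_eq !rmorphM /= -eqr_div ?dF0 // -xE.
Qed.

Lemma frac_map_tofrac (a : A) : frac_map phi a%:F = (phi a)%:F.
Proof.
have := @frac_map_div a 1 (oner_neq0 _).
by rewrite !rmorph1 !divr1.
Qed.

Fact frac_map_is_zmod_morphism : zmod_morphism (frac_map phi).
Proof.
move=> x y; have [n [d [d0 ->]]] := fractionP x; have [n' [d' [d'0 ->]]] := fractionP y.
have dF0 (D : idomainType) (a : D) : a != 0 -> a%:F != 0 by rewrite tofrac_eq0.
have phi_neq0 (a : A) : a != 0 -> phi a != 0.
  by rewrite -(inj_eq phi_inj) rmorph0.
rewrite -mulNr addf_div ?dF0 // -rmorphN -!rmorphM -rmorphD /=.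
rewrite !frac_map_div ?mulf_neq0 // -mulNr addf_div ?dF0 ?phi_neq0 //.
by rewrite -!rmorphN -!rmorphM -rmorphD /= !(rmorphD, rmorphM, rmorphN).
Qed.

Fact frac_map_is_monoid_morphism : monoid_morphism (frac_map phi).
Proof.
split=> [|x y]; first by rewrite -(rmorph1 (@tofrac A)) frac_map_tofrac !rmorph1.
have [n [d [d0 ->]]] := fractionP x; have [n' [d' [d'0 ->]]] := fractionP y.
by rewrite mulf_div -!rmorphM !frac_map_div ?mulf_neq0 // !rmorphM mulf_div.
Qed.

End FractionMaps.

(** Lets minimality over the fraction field be tested on polynomials with series as coefficients. *)
Lemma clear_denominators (D : idomainType) (q : {poly {fraction D}}) :
  exists (d : D) (q0 : {poly D}),
    d != 0 /\ map_poly (@tofrac D) q0 = (tofrac d) *: q.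
Proof.
elim/poly_ind: q => [|q c [d [q0 [d0 q0E]]]].
  by exists 1, 0; rewrite oner_neq0 rmorph0 scaler0.
have [n' [d' [d'0 ->]]] := fractionP c.
exists (d * d'), ((d' *: q0) * 'X + (d * n')%:P); split; first exact: mulf_neq0.
rewrite rmorphD rmorphM /= map_polyX map_polyC map_polyZ /= q0E scalerDr.
rewrite !rmorphM /= scalerA -scalerAl [tofrac d' * _]mulrC; congr (_ + _).
rewrite -mul_polyC -!polyCM; congr (_%:P).
by rewrite -mulrA; congr (_ * _); rewrite mulrC divfK // tofrac_eq0.
Qed.

(** * Subfields generated over the base field *)

Section Adjunction.
Variables (K L : fieldType) (iota : K -> L).
Implicit Types A B : set L.

Lemma adjoinP A x : adjoin iota A x <->
  forall P : set L, divring_closed (in_set P) ->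
    (forall y, P (iota y)) -> (forall a, A a -> P a) -> P x.
Proof.
split=> [Ax P Pcl Pi PA|h P [Pcl PiA]].
  by apply: Ax; split=> // y [[k _ <-]|/PA].
apply: h => // [y|a Aa]; apply: PiA; [by left; exists y|by right].
Qed.

Lemma sub_adjoin A x : A x -> adjoin iota A x.
Proof. by move=> Ax; apply/adjoinP => P _ _; apply. Qed.

Lemma base_adjoin A k : adjoin iota A (iota k).
Proof. by apply/adjoinP => P _ + _; apply. Qed.

Lemma adjoin_closed A : divring_closed (in_set (adjoin iota A)).
Proof.
split=> [|x y|x y]; rewrite ?inE.
- by apply/adjoinP => P [P1 _ _] _ _; move: P1; rewrite inE.
- move=> /adjoinP Ax /adjoinP Ay; apply/adjoinP => P Pcl Pi PA.
  have [_ PB _] := Pcl.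
  by have := PB x y; rewrite !inE; apply; [apply: Ax|apply: Ay].
- move=> /adjoinP Ax /adjoinP Ay; apply/adjoinP => P Pcl Pi PA.
  have [_ _ PB] := Pcl.
  by have := PB x y; rewrite !inE; apply; [apply: Ax|apply: Ay].
Qed.

Lemma adjoin_div A x y : adjoin iota A x -> adjoin iota A y -> adjoin iota A (x / y).
Proof. by have [_ _ h] := adjoin_closed A; have := h x y; rewrite !inE. Qed.

Lemma adjoinB A x y : adjoin iota A x -> adjoin iota A y -> adjoin iota A (x - y).
Proof. by have [_ h _] := adjoin_closed A; have := h x y; rewrite !inE. Qed.

Lemma adjoin1 A : adjoin iota A 1.
Proof. by have [h _ _] := adjoin_closed A; move: h; rewrite !inE. Qed.

Lemma adjoin0 A : adjoin iota A 0.
Proof. by rewrite -(subrr 1); apply: adjoinB; apply: adjoin1. Qed.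

Lemma adjoinD A x y : adjoin iota A x -> adjoin iota A y -> adjoin iota A (x + y).
Proof.
move=> Ax Ay; rewrite -[y]opprK -[- y]sub0r.
by do 2!apply: adjoinB => //; apply: adjoin0.
Qed.

Lemma adjoinM A x y : adjoin iota A x -> adjoin iota A y -> adjoin iota A (x * y).
Proof.
move=> Ax Ay; rewrite -[y]invrK -[y^-1]mul1r.
by do 2!apply: adjoin_div => //; apply: adjoin1.
Qed.

Lemma adjoin_sum A (I : eqType) (r : seq I) (F : I -> L) :
  (forall i, i \in r -> adjoin iota A (F i)) -> adjoin iota A (\sum_(i <- r) F i).
Proof.
move=> h; rewrite big_seq; elim/big_ind: _ => //; first exact: adjoin0.
exact: adjoinD.
Qed.

Lemma adjoin_horner A (p : {poly L}) x :
  (forall i, adjoin iota A p`_i) -> adjoin iota A x -> adjoin iota A p.[x].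
Proof.
move=> Ap Ax; elim/poly_ind: p Ap => [|p c IH] Ap; first by rewrite horner0; apply: adjoin0.
rewrite hornerMXaddC; apply: adjoinD; last by have := Ap 0%N; rewrite coefD coefMX coefC add0r.
apply: adjoinM => //; apply: IH => i.
by have := Ap i.+1; rewrite coefD coefMX coefC addr0.
Qed.

Lemma adjoin_min A B : (forall x, A x -> adjoin iota B x) ->
  forall x, adjoin iota A x -> adjoin iota B x.
Proof.
move=> AB x /adjoinP; apply; [exact: adjoin_closed|exact: base_adjoin|exact: AB].
Qed.

(** The fixed points of [sigma] form a subfield. *)
Lemma adjoin_fixed A (sigma : {rmorphism L -> L}) :
    (forall k, sigma (iota k) = iota k) -> (forall a, A a -> sigma a = a) ->
  forall x, adjoin iota A x -> sigma x = x.
Proof.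
move=> si sA x Ax.
have := (adjoinP A x).1 Ax [set y | sigma y = y]%classic; apply=> //.
split=> [|u v|u v]; rewrite !inE /=.
- exact: rmorph1.
- by rewrite rmorphB => -> ->.
- by rewrite fmorph_div => -> ->.
Qed.

End Adjunction.
HB.instance Definition _ (C : idomainType) n :=
  GRing.isZmodMorphism.Build {fraction {fps2 C}} {fraction {fps2 C}}
    (@puiseux_field_incl C n.+1)
    (frac_map_is_zmod_morphism (can_inj (@puiseux_inclK C n.+1 isT))).
HB.instance Definition _ (C : idomainType) n :=
  GRing.isMonoidMorphism.Build {fraction {fps2 C}} {fraction {fps2 C}}
    (@puiseux_field_incl C n.+1)
    (frac_map_is_monoid_morphism (can_inj (@puiseux_inclK C n.+1 isT))).

Lemma map_monic_inj (A B : nzRingType) (f : {rmorphism A -> B}) (p : {poly A}) :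
  injective f -> (map_poly f p \is monic) = (p \is monic).
Proof.
move=> f_inj; rewrite !monicE lead_coef_map_inj ?rmorph0 //.
by rewrite -[X in _ == X](rmorph1 f) (inj_eq f_inj).
Qed.

(** * Conjugates of a Puiseux series *)

Section GaloisAction.
Variables (C : idomainType) (n : nat) (z : C).
Local Notation m := n.+1.
Local Notation S := {fps2 C}.
Local Notation gT := ('I_m * 'I_m)%type.
Implicit Types (g h : gT) (f x y : S).

(* (a, b) acts by X^(1/m) |-> z^a X^(1/m) and Y^(1/m) |-> z^b Y^(1/m).         *)
Definition act g f : S := fps2_of (fun i j => z ^+ (g.1 * i + g.2 * j) * coef2 f i j).

Lemma coef2_act g f i j : coef2 (act g f) i j = z ^+ (g.1 * i + g.2 * j) * coef2 f i j.
Proof. by []. Qed.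

Fact act_is_zmod_morphism g : zmod_morphism (act g).
Proof.
by move=> f f'; apply: fps2P => i j; rewrite coef2B !coef2_act coef2B mulrBr.
Qed.

Fact act_is_monoid_morphism g : monoid_morphism (act g).
Proof.
split=> [|f f']; apply: fps2P => i j; rewrite coef2_act.
  rewrite coef21; case: eqP => [->|] /=; last by rewrite mulr0.
  by case: eqP => [->|]; rewrite ?mulr0 // !muln0 mulr1.
rewrite !coef2M mulr_sumr; apply: eq_bigr => k _.
rewrite mulr_sumr; apply: eq_bigr => l _; rewrite !coef2_act mulrACA -exprD.
congr (z ^+ _ * _); have := ltn_ord k; have := ltn_ord l; rewrite !ltnS => hl hk.
rewrite -{1}(subnKC hl) -{1}(subnKC hk); lia.
Qed.

HB.instance Definition _ g :=
  GRing.isZmodMorphism.Build S S (act g) (act_is_zmod_morphism g).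
HB.instance Definition _ g :=
  GRing.isMonoidMorphism.Build S S (act g) (act_is_monoid_morphism g).

Hypothesis zP : m.-primitive_root z.

Lemma act0 f : act 0 f = f.
Proof. by apply: fps2P => i j; rewrite coef2_act mul1r. Qed.

Lemma actD g h f : act (g + h) f = act g (act h f).
Proof.
apply: fps2P => i j; rewrite !coef2_act mulrA -exprD; congr (_ * _).
(* Addition in ['I_m] is modulo [m], so the two exponents of [z] agree only modulo [m]. *)
apply/eqP; rewrite (eq_prim_root_expr zP) /=; apply/eqP.
rewrite -modnDm !modnMml modnDm; congr (_ %% _)%N; lia.
Qed.

Lemma actNK g : cancel (act g) (act (- g)).
Proof. by move=> f; rewrite -actD addNr act0. Qed.

Lemma act_inj g : injective (act g).
Proof. exact: can_inj (actNK g). Qed.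

Lemma act_fixedP g f :
  act g f = f <-> forall i j, exponents f (i, j) -> (m %| g.1 * i + g.2 * j)%N.
Proof.
split=> [gf i j fij|h].
  rewrite (prim_order_dvd zP); have := congr1 (fun u => coef2 u i j) gf.
  by rewrite coef2_act -[RHS]mul1r => /(mulIf fij) ->.
apply: fps2P => i j; rewrite coef2_act.
have [->|fij] := eqVneq (coef2 f i j) 0; first by rewrite mulr0.
by have := h i j fij; rewrite (prim_order_dvd zP) => /eqP->; rewrite mul1r.
Qed.

Lemma act_incl g f : act g (puiseux_incl m f) = puiseux_incl m f.
Proof.
apply/act_fixedP => i j; rewrite /exponents /= /coef2 /=.
case: ifP => [/andP[mi mj] _|]; last by rewrite eqxx.
by rewrite dvdn_add // dvdn_mull.
Qed.

Lemma fixed_incl f : (forall g, act g f = f) -> puiseux_incl m (contract m f) = f.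
Proof.
move=> ff; apply: contractK => i j fij.
(* The two generators of the group force [m] to divide [i] and [j] separately. For m = 1 the index
   [inZp 1] is 0, hence the reductions of [1 %% m]. *)
have := (act_fixedP (inZp 1, ord0) f).1 (ff _) i j fij.
have := (act_fixedP (ord0, inZp 1) f).1 (ff _) i j fij.
rewrite /= !mul0n addn0 add0n.
rewrite !/dvdn -![((1 %% m) * _ %% m)%N]modnMml !modn_mod !modnMml !mul1n.
by move=> -> ->.
Qed.

Definition stab x : {set gT} := [set g | act g x == x].

(** One entry per group element, with repetitions; the multiplicity of an entry is the order of the
    stabilizer. *)
Definition conjugates x : seq S := [seq act g x | g <- enum (gT : finType)].

Definition orb x := undup (conjugates x).

Lemma conjugatesP x y : reflect (exists g, y = act g x) (y \in conjugates x).
Proof.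
apply: (iffP mapP) => [[g _ ->]|[g ->]]; first by exists g.
by exists g; rewrite ?mem_enum.
Qed.

Lemma orbP x y : reflect (exists g, y = act g x) (y \in orb x).
Proof. by rewrite mem_undup; apply: conjugatesP. Qed.

Lemma orb_refl x : x \in orb x.
Proof. by apply/orbP; exists 0; rewrite act0. Qed.

(** The elements sending [x] to [act h x] form the coset of [h] modulo the stabilizer. *)
Lemma count_conjugates x y : y \in orb x -> count_mem y (conjugates x) = #|stab x|.
Proof.
move=> /orbP[h ->]; rewrite count_map -(card_imset (stab x) (addrI h)).
rewrite -sum1_count big_enum_cond sum1dep_card /=.
congr #|pred_of_set _|; apply/setP => g; rewrite inE.
apply/eqP/imsetP => [gh|[g' ]].
  exists (g - h); last by rewrite addrC subrK.
  by rewrite inE addrC actD gh actNK.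
by rewrite inE => /eqP g'x ->; rewrite actD g'x.
Qed.

Lemma perm_orb_act g x : perm_eq (map (act g) (orb x)) (orb x).
Proof.
apply: uniq_perm; rewrite ?(map_inj_uniq (@act_inj g)) ?undup_uniq // => y.
apply/mapP/orbP => [[_ /orbP[h ->] ->]|[h ->]].
  by exists (g + h); rewrite actD.
exists (act (h - g) x); first by apply/orbP; exists (h - g).
by rewrite -actD addrC subrK.
Qed.

Definition minpolyS x : {poly S} := \prod_(y <- orb x) ('X - y%:P).

Lemma act_minpolyS g x : map_poly (act g) (minpolyS x) = minpolyS x.
Proof.
rewrite /minpolyS rmorph_prod /= -[RHS](perm_big _ (perm_orb_act g x)) /= big_map.
by apply: eq_bigr => y _; rewrite rmorphB /= map_polyX map_polyC.
Qed.

Lemma root_minpolyS x : root (minpolyS x) x.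
Proof. by rewrite root_prod_XsubC orb_refl. Qed.

Definition contract_poly (P : {poly S}) : {poly S} :=
  \poly_(i < size P) contract m P`_i.

Lemma contract_polyK (P : {poly S}) : (forall g, map_poly (act g) P = P) ->
  map_poly (puiseux_incl m) (contract_poly P) = P.
Proof.
move=> Pfix; apply/polyP => i; rewrite coef_map coef_poly /=.
case: ltnP => iP; last by rewrite rmorph0 nth_default.
by apply: fixed_incl => g; rewrite -[in RHS](Pfix g) coef_map.
Qed.

Definition minpolyR x := contract_poly (minpolyS x).

Lemma map_minpolyR x : map_poly (puiseux_incl m) (minpolyR x) = minpolyS x.
Proof. by apply: contract_polyK => g; apply: act_minpolyS. Qed.

Lemma size_minpolyR x : size (minpolyR x) = (size (orb x)).+1.
Proof.
rewrite -(size_map_inj_poly (can_inj (@puiseux_inclK C m isT))) ?rmorph0 //.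
by rewrite map_minpolyR size_prod_XsubC.
Qed.

Lemma minpolyR_monic x : minpolyR x \is monic.
Proof.
rewrite -(map_monic_inj _ (can_inj (@puiseux_inclK C m isT))).
by rewrite map_minpolyR monic_prod_XsubC.
Qed.

(** The coefficients are invariant under the group, so all the conjugates of [x], which are distinct
    in the orbit, are roots. *)
Lemma size_annihilating_poly x (q : {poly S}) : q != 0 ->
  root (map_poly (puiseux_incl m) q) x -> (size (orb x) < size q)%N.
Proof.
move=> q0 qx.
rewrite -(size_map_inj_poly (can_inj (@puiseux_inclK C m isT))) ?rmorph0 //.
apply: max_poly_roots; last exact: undup_uniq.
  rewrite -size_poly_eq0 (size_map_inj_poly (can_inj (@puiseux_inclK C m isT))) ?rmorph0 //.
  by rewrite size_poly_eq0.
apply/allP => _ /orbP[g ->]; rewrite rootE.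
have -> : map_poly (puiseux_incl m) q = map_poly (act g) (map_poly (puiseux_incl m) q).
  by apply/polyP => i; rewrite !coef_map /= act_incl.
by rewrite horner_map (rootP qx) rmorph0.
Qed.

Local Notation iota := (@puiseux_field_incl C m).

Lemma puiseux_field_incl_tofrac (f : S) : iota (tofrac f) = tofrac (puiseux_incl m f).
Proof. exact: (frac_map_tofrac (can_inj (@puiseux_inclK C m isT))). Qed.

Lemma map_puiseux_field_incl (q : {poly S}) :
  map_poly iota (map_poly (@tofrac S) q) =
  map_poly (@tofrac S) (map_poly (puiseux_incl m) q).
Proof. by apply/polyP => i; rewrite !coef_map /= puiseux_field_incl_tofrac. Qed.

Lemma root_tofrac (q : {poly S}) x :
  root (map_poly iota (map_poly (@tofrac S) q)) (tofrac x) =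
  root (map_poly (puiseux_incl m) q) x.
Proof. by rewrite map_puiseux_field_incl !rootE horner_map tofrac_eq0. Qed.

Lemma tofrac_inj : injective (@tofrac S).
Proof. by move=> f g /eqP; rewrite tofrac_eq => /eqP. Qed.

Lemma minpoly_over_seriesP x (F : {poly S}) :
  minpoly_over_series m x F <-> F = minpolyR x.
Proof.
have tofrac_size (q : {poly S}) : size (map_poly (@tofrac S) q) = size q.
  by rewrite (size_map_inj_poly tofrac_inj) ?rmorph0.
have tofrac_monic (q : {poly S}) : (map_poly (@tofrac S) q \is monic) = (q \is monic).
  by rewrite (map_monic_inj _ tofrac_inj).
have Rroot : root (map_poly (puiseux_incl m) (minpolyR x)) x.
  by rewrite map_minpolyR root_minpolyS.
split=> [[Fmon Froot Fmin]|->]; last first.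
  split=> [||q q0 qx]; rewrite ?tofrac_monic ?minpolyR_monic ?root_tofrac //.
  have [d [q0' [d0 q0E]]] := clear_denominators q.
  have dF0 : tofrac d != 0 by rewrite tofrac_eq0.
  rewrite tofrac_size -(size_scale q dF0) -q0E tofrac_size size_minpolyR.
  apply: size_annihilating_poly.
    by rewrite -size_poly_eq0 -tofrac_size q0E size_poly_eq0 scaler_eq0 negb_or dF0.
  by rewrite -root_tofrac q0E map_polyZ rootZ // fmorph_eq0.
rewrite tofrac_monic in Fmon; rewrite root_tofrac in Froot.
have sizeF : size F = (size (orb x)).+1.
  apply/eqP; rewrite eqn_leq size_annihilating_poly ?monic_neq0 // andbT.
  rewrite -size_minpolyR -(tofrac_size F) -(tofrac_size (minpolyR x)).
  apply: Fmin; rewrite ?root_tofrac //.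
  by rewrite monic_neq0 // tofrac_monic minpolyR_monic.
(* Uniqueness: two monic annihilators of the same degree differ by an annihilator of smaller degree,
   which must be 0. *)
apply/eqP; rewrite -subr_eq0; apply: contraT => D0.
have Droot : root (map_poly (puiseux_incl m) (F - minpolyR x)) x.
  by rewrite rmorphB rootE hornerD hornerN (rootP Froot) (rootP Rroot) subrr.
have := size_annihilating_poly D0 Droot; rewrite ltnNge => /negP[].
apply/leq_sizeP => j; rewrite leq_eqVlt => /predU1P[<-|hj]; rewrite coefB.
  have := monicP Fmon; rewrite lead_coefE sizeF /= => ->.
  by have := monicP (minpolyR_monic x); rewrite lead_coefE size_minpolyR /= => ->; rewrite subrr.
by rewrite !nth_default ?subrr // ?sizeF ?size_minpolyR.
Qed.

End GaloisAction.
(** * Privileged exponents *)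

Section PrivilegedExponents.
Variables (C : fieldType) (n : nat) (z : C).
Local Notation m := n.+1.
Local Notation S := {fps2 C}.
Local Notation gT := ('I_m * 'I_m)%type.
Hypotheses (zP : m.-primitive_root z) (charC : [pchar C] =i pred0).
Local Notation act := (@act C n z).
Local Notation stab := (@stab C n z).
Local Notation orb := (@orb C n z).
Local Notation iota := (@puiseux_field_incl C m).
Local Notation adjoin := (adjoin iota).
Implicit Types (g h : gT) (f x y w : S).

Lemma fps2_natr_neq0 k : (0 < k)%N -> k%:R != 0 :> S.
Proof.
move=> k0; rewrite -(rmorph_nat (@fps2_const C)).
apply/eqP => /(congr1 (fun f => coef2 f 0 0)); rewrite [LHS]/coef2 /= => /eqP.
by rewrite ((pcharf0P C).1 charC) eqn0Ngt k0.
Qed.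

(* Lagrange interpolation: sum_g (g w) (g H), with H = F / (Z - x), has        *)
(* coefficients in R and its value at x is a multiple of w, by a factor that   *)
(* does not depend on w.                                                       *)
Lemma fixed_adjoin x w : stab x \subset stab w -> adjoin [set tofrac x]%classic (tofrac w).
Proof.
move=> xw; pose H : {poly S} := \prod_(y <- rem x (orb x)) ('X - y%:P).
have FH : minpolyS n z x = ('X - x%:P) * H.
  by rewrite /minpolyS (big_rem x) //= orb_refl.
pose P w : {poly S} := \sum_g (act g w)%:P * map_poly (act g) H.
have Pfix u h : map_poly (act h) (P u) = P u.
  rewrite /P rmorph_sum [RHS](reindex_inj (addrI h)) /=; apply: eq_bigr => g _.
  rewrite rmorphM /= map_polyC /= actD //; congr (_ * _).
  by apply/polyP => i; rewrite !coef_map /= actD.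
have Px u : stab x \subset stab u -> (P u).[x] = u * (#|stab x|%:R * H.[x]).
  move=> xu; rewrite /P horner_sum (bigID (fun g => g \in stab x)) /=.
  (* For [g] outside the stabilizer, [act (- g) x] is a conjugate other than [x], hence a root of
     [H]; applying [g] shows that [x] is a root of the transform of [H]. *)
  rewrite [X in _ + X]big1 ?addr0 => [|g gx]; last first.
    rewrite hornerM hornerC; suff -> : (map_poly (act g) H).[x] = 0 by rewrite mulr0.
    have xE : x = act g (act (- g) x) by rewrite -actD // subrr act0.
    rewrite {1}xE horner_map /= (_ : H.[act (- g) x] = 0) ?rmorph0 //.
    apply/rootP; rewrite root_prod_XsubC mem_rem_uniq ?undup_uniq // inE.
    apply/andP; split; last by apply/orbP => //; exists (- g).
    apply: contra gx => /eqP e; rewrite e in xE.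
    by rewrite inE -xE.
  rewrite mulr_natl mulrnAr -sumr_const; apply: eq_bigr => g gx.
  have /eqP gu : act g u == u by have := fintype.subsetP xu g gx; rewrite inE.
  rewrite hornerM hornerC gu; congr (_ * _.[_]).
  (* For [g] in the stabilizer, both the minimal polynomial and Z - x are invariant, so their
     quotient [H] is too. *)
  have Xx0 : 'X - x%:P != 0 by rewrite polyXsubC_eq0.
  apply: (mulfI Xx0); rewrite -FH -[RHS](act_minpolyS zP g) FH rmorphM /=.
  have -> : map_poly (act g) ('X - x%:P) = 'X - (act g x)%:P.
    rewrite rmorphB /= map_polyX. by rewrite map_polyC.
  by move: gx; rewrite inE => /eqP->.
have Padj u : adjoin [set tofrac x]%classic (tofrac (P u).[x]).
  rewrite -(contract_polyK zP (Pfix u)) -horner_map -map_puiseux_field_incl.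
  apply: adjoin_horner; last exact: sub_adjoin.
  by move=> i; rewrite coef_map; apply: base_adjoin.
have a0 : #|stab x|%:R * H.[x] != 0.
  apply: mulf_neq0.
    apply: fps2_natr_neq0; rewrite card_gt0; apply/finset.set0Pn; exists 0.
    by rewrite inE act0.
  rewrite -[_ == 0]/(root H x) root_prod_XsubC mem_rem_uniq ?undup_uniq //.
  by rewrite inE eqxx.
have x1 : stab x \subset stab 1 by apply/fintype.subsetP => g _; rewrite inE rmorph1.
have -> : tofrac w = tofrac (P w).[x] / tofrac (P 1).[x].
  rewrite !Px // mul1r rmorphM /= mulfK // tofrac_eq0 //.
exact: adjoin_div.
Qed.

(** The easy half of the Galois correspondence: [act g] extends to an endomorphism of the fraction
    field that fixes the base field and [A], hence also [x]. *)
Lemma adjoin_stab x (A : set {fraction S}) g :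
    (forall a, A a -> exists2 f : S, a = tofrac f & act g f = f) ->
  adjoin A (tofrac x) -> g \in stab x.
Proof.
move=> Afix Ax; have inj := act_inj zP (g := g).
pose sM := GRing.isMonoidMorphism.Build _ _ _ (frac_map_is_monoid_morphism inj).
pose sZ := GRing.isZmodMorphism.Build _ _ _ (frac_map_is_zmod_morphism inj).
pose sigma : {rmorphism {fraction S} -> {fraction S}} :=
  HB.pack (frac_map (act g)) sZ sM.
have sT f : sigma (tofrac f) = tofrac (act g f) by exact: (frac_map_tofrac inj).
have := adjoin_fixed (sigma := sigma) _ _ Ax; rewrite sT inE => h.
rewrite -tofrac_eq; apply/eqP/h => [k|_ /Afix[f -> gf]]; last by rewrite sT gf.
have [a [b [b0 ->]]] := fractionP k.
have -> : iota (tofrac a / tofrac b) =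
    tofrac (puiseux_incl m a) / tofrac (puiseux_incl m b).
  by rewrite fmorph_div /= !puiseux_field_incl_tofrac.
by rewrite fmorph_div !sT !act_incl.
Qed.

Lemma coef2_mono a b i j : coef2 (fps2_mono C a b) i j = ((i == a) && (j == b))%:R.
Proof. by []. Qed.

Lemma act_monoP g (p : nat * nat) :
  act g (fps2_mono C p.1 p.2) = fps2_mono C p.1 p.2 <->
  (m %| g.1 * p.1 + g.2 * p.2)%N.
Proof.
split=> [/(act_fixedP zP) h|h].
  by apply: h; rewrite /exponents /= coef2_mono !eqxx oner_eq0.
apply/(act_fixedP zP) => i j; rewrite /exponents /= coef2_mono.
by case: andP => [[/eqP-> /eqP->] _ //|_]; rewrite eqxx.
Qed.

(** Both sets consist of the group elements fixing the field generated by [x], which is also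
    generated by the monomials of [E]. *)
Lemma privileged_annihilator x (E : seq (nat * nat)) :
  privileged m x E -> annihilator m E = stab x.
Proof.
move=> [Ex adjE]; apply/setP => g; apply/idP/idP.
  rewrite inE => /allP gE; apply: (@adjoin_stab x
    [set tofrac (fps2_mono C p.1 p.2) | p in [set` E]]%classic g); last first.
    by rewrite -adjE; apply: sub_adjoin.
  move=> _ [p /= pE <-]; exists (fps2_mono C p.1 p.2) => //.
  by apply/act_monoP; apply: gE.
move=> gx; rewrite inE; apply/allP => p pE; apply/act_monoP.
suff : g \in stab (fps2_mono C p.1 p.2) by rewrite inE => /eqP.
apply: (@adjoin_stab _ [set tofrac x]%classic); first by move=> _ ->; exists x => //; apply/eqP; rewrite inE in gx.
by rewrite adjE; apply: sub_adjoin; exists p.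
Qed.

(** Guarantees that the choice in [puiseux_d] is not the default of [xget]. For each [g] not fixing
    [x], one exponent of [x] moved by [g] is kept; these finitely many exponents determine the
    stabilizer, hence the field. *)
Lemma privileged_exists x : exists E, privileged m x E.
Proof.
have [e eP] : {e : gT -> nat * nat & forall g, g \notin stab x ->
    exponents x (e g) /\ ~~ (m %| g.1 * (e g).1 + g.2 * (e g).2)%N}.
  apply: (@boolp.choice gT (nat * nat)%type (fun g p => g \notin stab x ->
    exponents x p /\ ~~ (m %| g.1 * p.1 + g.2 * p.2)%N)) => g.
  have [gx|gx] := boolP (g \in stab x); first by exists (0%N, 0%N).
  apply: contrapT => nex; case/negP: gx; rewrite inE; apply/eqP/(act_fixedP zP) => i j xij.
  by apply: contrapT => /negP mij; apply: nex; exists (i, j).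
pose E := undup [seq e g | g <- enum (gT : finType) & g \notin stab x].
have EP p : p \in E -> exists2 g, g \notin stab x & p = e g.
  by rewrite mem_undup => /mapP[g]; rewrite mem_filter => /andP[gx _] ->; exists g.
have eE g : g \notin stab x -> e g \in E.
  by move=> gx; rewrite mem_undup; apply: map_f; rewrite mem_filter gx mem_enum.
have Ex p : p \in E -> exponents x p by move=> /EP[g /eP[]] ? _ ->.
(* The sum of the monomials of E is a primitive element of the field they      *)
(* generate.                                                                   *)
pose theta : S := \sum_(p <- E) fps2_mono C p.1 p.2.
have thetaE p : p \in E -> exponents theta p.
  move=> pE; rewrite /exponents /= /theta coef2_sum (bigD1_seq p) ?undup_uniq //=.
  rewrite coef2_mono !eqxx big1 ?addr0 ?oner_eq0 // => q qp; rewrite coef2_mono.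
  by case: andP => // -[/eqP e1 /eqP e2]; case/eqP: qp; case: p q e1 e2 {pE} => [? ?] [? ?] /= -> ->.
exists E; split=> //; apply/seteqP; split=> y; apply: adjoin_min => {y}.
  move=> _ ->; apply: (adjoin_min (A := [set tofrac theta]%classic)).
    move=> _ ->; rewrite /theta rmorph_sum; apply: adjoin_sum => p pE /=.
    by apply: sub_adjoin; exists p.
  (* An element fixing [theta] fixes every monomial of [E], whereas any [g] outside the stabilizer
     of [x] moves the monomial of exponent [e g]. *)
  apply: fixed_adjoin; apply/fintype.subsetP => g; rewrite inE => /eqP gt.
  apply: contraT => gx; have [_ /negP[]] := eP g gx.
  by apply: ((act_fixedP zP g theta).1 gt); have := thetaE _ (eE g gx); case: (e g).
move=> _ [p /= pE <-]; apply: fixed_adjoin; apply/fintype.subsetP => g.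
rewrite inE => /eqP gx; rewrite inE; apply/eqP/act_monoP.
by apply: ((act_fixedP zP g x).1 gx); have := Ex p pE; case: p pE.
Qed.

Lemma puiseux_dE x : puiseux_d m x = #|stab x|.
Proof.
rewrite /puiseux_d -card_annihilator //.
by rewrite (privileged_annihilator (xgetPex _ (privileged_exists x))).
Qed.

End PrivilegedExponents.
(** * Tangent cones *)

(** In characteristic 0 the polynomial X^m - 1 is separable, so it has m distinct roots, and these
    include a primitive one. *)
Lemma has_primitive_root (C : closedFieldType) n :
  [pchar C] =i pred0 -> exists z : C, (n.+1).-primitive_root z.
Proof.
move=> charC; have n0 : n.+1%:R != 0 :> C by rewrite ((pcharf0P C).1 charC).
have [s sE] := closed_field_poly_normal ('X^(n.+1) - 1 : {poly C}).
rewrite lead_coefXnsubC // scale1r in sE.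
have s_uniq : uniq s by rewrite -separable_prod_XsubC -sE separable_Xn_sub_1.
have s_size : size s = n.+1.
  by have := congr1 (fun p : {poly C} => size p) sE; rewrite size_prod_XsubC size_XnsubC // => -[].
have /hasP[z _ zP] : has n.+1.-primitive_root s; last by exists z.
apply: has_prim_root; rewrite ?s_size //; apply/allP => y ys.
by rewrite /root_of_unity sE root_prod_XsubC.
Qed.

Lemma count_undup_const (T : eqType) (s : seq T) (k : nat) (P : pred T) :
  (forall y, y \in s -> count_mem y s = k) -> (k * count P (undup s))%N = count P s.
Proof.
move=> sk; rewrite -!sum1_count -[RHS]big_undup_iterop_count big_distrr /=.
rewrite big_seq_cond [RHS]big_seq_cond; apply: eq_bigr => y /andP[+ _].
by rewrite mem_undup => ys; rewrite sk // Monoid.iteropE iter_addn_0 mul1n muln1.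
Qed.

(** * Initial forms of conjugates, and tangent cones for order at least 1 *)

Section GradedConjugates.
Variables (C : fieldType) (n : nat) (z : C).
Local Notation m := n.+1.
Local Notation S := {fps2 C}.
Hypotheses (zP : m.-primitive_root z).
Local Notation act := (@act C n z).
Local Notation stab := (@stab C n z).
Local Notation orb := (@orb C n z).
Local Notation minpolyR := (@minpolyR C n z).
Local Notation minpolyS := (@minpolyS C n z).
Implicit Types (x y : S).

Lemma hpart2_act d g x : hpart2 d (act g x) = act g (hpart2 d x).
Proof.
apply: fps2P => i j; rewrite coef2_act !coef2_hpart2 coef2_act.
by case: (_ == d); rewrite ?mulr0.
Qed.

Lemma order_ge_orb w x y : order_ge w x -> y \in orb x -> order_ge w y.
Proof. by move=> xw /orbP[g ->] i j ij; rewrite coef2_act xw ?mulr0. Qed.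

Lemma coef2_minpolyR x c a b :
  coef2 (minpolyR x)`_c a b = coef2 (minpolyS x)`_c (m * a) (m * b).
Proof. by rewrite -(map_minpolyR zP) coef_map /= coef2_puiseux_incl. Qed.

Lemma minpolyR_coef_lt w x c a b : order_ge w x ->
  (m * (a + b) < w * (size (orb x) - c))%N -> coef2 (minpolyR x)`_c a b = 0.
Proof.
move=> xw ab; rewrite coef2_minpolyR.
have h : order_ge (w * (size (orb x) - c)) (minpolyS x)`_c.
  by apply: coef_prod_XsubC_order => y; apply: order_ge_orb.
by rewrite h // -mulnDr.
Qed.

Lemma minpolyR_coef_eq w x c a b : order_ge w x -> (c <= size (orb x))%N ->
  (m * (a + b) = w * (size (orb x) - c))%N ->
  coef2 (minpolyR x)`_c a b =
  coef2 (\prod_(y <- orb x) ('X - (hpart2 w y)%:P))`_c (m * a) (m * b).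
Proof.
move=> xw cN ab; rewrite coef2_minpolyR -hpart2_coef_prod_XsubC //; last first.
  by move=> y; apply: order_ge_orb.
by rewrite coef2_hpart2 -mulnDr ab eqxx.
Qed.

Lemma coef_minpolyR_gt x c : (size (orb x) < c)%N -> (minpolyR x)`_c = 0.
Proof. by move=> cN; rewrite nth_default // size_minpolyR. Qed.

Lemma coef_minpolyR_top x : (minpolyR x)`_(size (orb x)) = 1.
Proof.
by have := monicP (minpolyR_monic zP x); rewrite lead_coefE size_minpolyR.
Qed.

(* The fibres of hpart2 w : orb x -> orb (hpart2 w x) all have the same size,  *)
(* counted by comparing stabilizers.                                           *)
Lemma count_hpart2_orb w x y : y \in orb (hpart2 w x) ->
  (#|stab x| * count_mem y [seq hpart2 w t | t <- orb x])%N = #|stab (hpart2 w x)|.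
Proof.
move=> yx; rewrite count_map (@count_undup_const _ (conjugates n z x)).
  rewrite -(count_conjugates zP yx) !count_map; apply: eq_count => g /=.
  by rewrite hpart2_act.
by move=> t tx; apply: count_conjugates => //; rewrite mem_undup.
Qed.

Lemma stab_gt0 x : (0 < #|stab x|)%N.
Proof.
by rewrite card_gt0; apply/finset.set0Pn; exists 0; rewrite inE act0.
Qed.

Lemma stab_hpart2_dvd w x : (#|stab x| %| #|stab (hpart2 w x)|)%N.
Proof.
by rewrite -(@count_hpart2_orb w x (hpart2 w x)) ?dvdn_mulr ?orb_refl.
Qed.

Lemma prod_hpart2_orb w x :
  \prod_(y <- orb x) ('X - (hpart2 w y)%:P) =
  minpolyS (hpart2 w x) ^+ (#|stab (hpart2 w x)| %/ #|stab x|).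
Proof.
rewrite -(big_map (hpart2 w) predT (fun y => 'X - y%:P)) /=.
rewrite -big_undup_iterop_count /minpolyS -prodrXl.
rewrite (perm_big (orb (hpart2 w x))) /=; last first.
  apply: uniq_perm; rewrite ?undup_uniq // => y; rewrite mem_undup.
  apply/mapP/orbP => [[_ /orbP[g ->] ->]|[g ->]]; first by exists g; rewrite hpart2_act.
  by exists (act g x); rewrite ?hpart2_act //; apply/orbP; exists g.
rewrite big_seq [RHS]big_seq; apply: eq_bigr => y yx.
by rewrite -(count_hpart2_orb yx) mulKn ?stab_gt0.
Qed.

Lemma tangent_cone_minpolyR w x : order_ge w x -> (m <= w)%N ->
  tangent_cone_eq (minpolyR x) = hpart3 (size (orb x)) (minpolyR x).
Proof.
move=> xw mw; apply: tangent_cone_eqE => [|a b c abc].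
  apply/eqP => /(congr1 (mcoeff (mnm3 0 0 (size (orb x))))).
  rewrite mcoeff_hpart3 !add0n eqxx mcoeff0 coef_minpolyR_top coef21 /= => /eqP.
  by rewrite oner_eq0.
(* If a + b + c < N then m(a+b) < m(N-c) <= w(N-c), with N the size of the orbit. *)
by rewrite (minpolyR_coef_lt xw) //; nia.
Qed.

Lemma tangent_cone_order_gt x : order_ge m.+1 x ->
  tangent_cone_eq (minpolyR x) = 'X_2 ^+ size (orb x).
Proof.
move=> xw; rewrite (tangent_cone_minpolyR xw) //.
apply/mpolyP => k; have [a [b [c ->]]] := mnm3_eta k.
rewrite mcoeff_hpart3 mcoeffXn.
have -> : (U_(2) *+ size (orb x))%MM = mnm3 0 0 (size (orb x)).
  apply/mnmP => i; rewrite mulmnE mnm1E mnmE.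
  by case: i => [[|[|[|//]]] ?] /=; rewrite ?mul1n ?mul0n.
rewrite mnm3_inj; case: eqP => abc; last first.
  by case: and3P => // -[/eqP a0 /eqP b0 /eqP c0]; case: abc; rewrite -a0 -b0 -c0.
have [cN|cN] := eqVneq (size (orb x)) c.
  move: abc; rewrite -cN => abc.
  have -> : a = 0%N by lia.
  have -> : b = 0%N by lia.
  by rewrite coef_minpolyR_top coef21.
rewrite !andbF (minpolyR_coef_lt xw) //.
by rewrite (_ : size (orb x) - c = a + b)%N; [nia | lia].
Qed.

Definition minform x := hpart3 (size (orb x)) (minpolyR x).

(** For [x] homogeneous of order 1, giving Z its usual degree makes the whole minimal polynomial
    homogeneous, so it is a polynomial in X, Y, Z. *)
Lemma mpoly_series_minform x : hpart2 m x = x -> mpoly_series (minform x) = minpolyR x.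
Proof.
move=> xh; apply/polyP => c; apply: fps2P => a b.
rewrite coef2_mpoly_series mcoeff_hpart3; case: eqP => // abc.
have [cN|cN] := leqP c (size (orb x)); last by rewrite coef_minpolyR_gt.
have xw : order_ge m x by rewrite -xh; apply: order_ge_hpart2.
have h : hpart2 (m * (size (orb x) - c)) (minpolyS x)`_c = (minpolyS x)`_c.
  rewrite hpart2_coef_prod_XsubC //; last by move=> y; apply: order_ge_orb.
  suff -> : \prod_(y <- orb x) ('X - (hpart2 m y)%:P) = minpolyS x by [].
  by apply: eq_big_seq => _ /orbP[g ->]; rewrite hpart2_act xh.
rewrite coef2_minpolyR -h coef2_hpart2 ifF // -mulnDr eqn_mul2l /=.
by apply/negbTE/eqP => e0; apply: abc; rewrite e0 subnK.
Qed.

Lemma tangent_cone_order_eq x : order_ge m x ->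
  tangent_cone_eq (minpolyR x) =
  minform (hpart2 m x) ^+ (#|stab (hpart2 m x)| %/ #|stab x|).
Proof.
move=> xw; rewrite (tangent_cone_minpolyR xw) //; apply: mpoly_series_inj.
rewrite mpoly_seriesXn mpoly_series_minform ?hpart2_idem //.
set e := (_ %/ _)%N; apply/polyP => c; apply: fps2P => a b.
have eE : map_poly (puiseux_incl m) (minpolyR (hpart2 m x) ^+ e) =
    \prod_(y <- orb x) ('X - (hpart2 m y)%:P).
  by rewrite prod_hpart2_orb rmorphXn /= (map_minpolyR zP).
have incl_coef i j : coef2 (minpolyR (hpart2 m x) ^+ e)`_c i j =
    coef2 (\prod_(y <- orb x) ('X - (hpart2 m y)%:P))`_c (m * i) (m * j).
  by rewrite -eE coef_map /= coef2_puiseux_incl.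
rewrite coef2_mpoly_series mcoeff_hpart3 incl_coef.
have [cN|cN] := leqP c (size (orb x)); last first.
  rewrite ifF; last by lia.
  by rewrite nth_default // size_prod_XsubC.
case: eqP => abc.
  by rewrite (minpolyR_coef_eq xw) //; congr (_ * _)%N; lia.
(* Off the total degree of the cone the right-hand side vanishes too: this coefficient is
   homogeneous, of another degree. *)
rewrite -hpart2_coef_prod_XsubC //; last by move=> y; apply: order_ge_orb.
rewrite coef2_hpart2 ifF // -mulnDr eqn_mul2l /=.
by apply/negbTE/eqP => e0; apply: abc; rewrite e0 subnK.
Qed.

(** In a factorization, one factor vanishes at [x], so its Z-degree is at least the size of the
    orbit. That is already the total degree of the product, so the cofactor is constant. *)
Lemma minform_irreducible x : hpart2 m x = x -> irreducible_elt (minform x).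
Proof.
move=> xh; have Fmon := minpolyR_monic zP x.
have orb_gt0 : (0 < size (orb x))%N by case: (orb x) (orb_refl n z x).
have G0 : minform x != 0.
  apply: contraTneq Fmon => G0; rewrite -mpoly_series_minform // G0.
  have -> : mpoly_series (0 : {mpoly C[3]}) = 0.
    by apply/polyP => c; apply: fps2P => a b; rewrite coef2_mpoly_series mcoeff0 coef0.
  by rewrite monicE lead_coef0 eq_sym oner_eq0.
have GsizeP : size (mpoly_series (minform x)) = (size (orb x)).+1.
  by rewrite mpoly_series_minform ?size_minpolyR.
have unitP (u : {mpoly C[3]}) : u != 0 -> (msize u <= 1)%N -> u \is a GRing.unit.
  move=> u0 /msize1_polyC uE; apply/unitrP; rewrite uE in u0 *.
  have c0 : u@_0 != 0 by apply: contraNneq u0 => ->; rewrite mpolyC0.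
  by exists (u@_0)^-1%:MP; rewrite -!mpolyCM mulVf ?mulfV // mpolyC1.
have factor a b : minform x = a * b ->
    root (map_poly (puiseux_incl m) (mpoly_series a)) x -> b \is a GRing.unit.
  move=> Gab ax; have ab0 : a * b != 0 by rewrite -Gab.
  move: (ab0); rewrite mulf_eq0 negb_or => /andP[a0 b0]; apply: unitP => //.
  have sa : (size (orb x) < msize a)%N.
    apply: leq_trans (mpoly_series_size a); apply: (size_annihilating_poly zP _ ax).
    apply: contraNneq a0 => a0; apply/eqP/mpoly_series_inj; rewrite a0.
    by apply/polyP => c; apply: fps2P => i j; rewrite coef2_mpoly_series mcoeff0 coef0.
  have := msize_hpart3 (size (orb x)) (minpolyR x); rewrite -/(minform x) Gab.
  by rewrite msizeM //; move: sa; move: (size (orb x)) (msize a) (msize b) => *; lia.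
split=> // [|a b Gab].
  apply/negP => /unitrP[u [uG _]].
  have := congr1 (fun p => size (mpoly_series p)) uG.
  rewrite mpoly_seriesM mpoly_series1 size_poly1 mpoly_series_minform //.
  have U0 : mpoly_series u != 0.
    apply/eqP => u0; have := congr1 (@mpoly_series C) uG.
    by rewrite mpoly_seriesM u0 mul0r mpoly_series1 => /eqP; rewrite eq_sym oner_eq0.
  rewrite size_Mmonic // (size_minpolyR zP) addnS /=.
  move: U0 orb_gt0; rewrite -size_poly_gt0.
  by move: (size (mpoly_series u)) (size (orb x)) => *; lia.
have : root (map_poly (puiseux_incl m) (mpoly_series (minform x))) x.
  by rewrite mpoly_series_minform // (map_minpolyR zP) root_minpolyS.
rewrite Gab mpoly_seriesM rmorphM rootM => /orP[ax|bx]; first by right; apply: (factor a).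
by left; apply: (factor b) => //; rewrite mulrC.
Qed.

End GradedConjugates.

(** * Tangent cones for order less than 1 *)

Section SmallOrder.
Variables (C : closedFieldType) (n : nat) (z : C).
Local Notation m := n.+1.
Hypothesis zP : m.-primitive_root z.

Lemma tangent_cone_order_lt (x : {fps2 C}) : x != 0 -> (order2 x < m)%N ->
  exists2 s : seq {mpoly C[3]}, (forall l, l \in s -> linear_form l)
    & same_equation (tangent_cone_eq (minpolyR n z x)) (\prod_(l <- s) l).
Proof.
move=> x0 wm; set w := order2 x in wm; pose F := minpolyR n z x.
pose N := size (orb n z x); have xw : order_ge w x by apply: order_ge_order2.
(* Up to sign the constant coefficient is the product of the conjugates, whose parts of degree [w]
   are all nonzero; its order is therefore exactly w N. *)
have [i [j [ij Fij]]] : exists i j, (i + j = w * N)%N /\ coef2 (minpolyS n z x)`_0 i j != 0.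
  have h0 : hpart2 (w * (N - 0)) (minpolyS n z x)`_0 != 0.
    rewrite hpart2_coef_prod_XsubC //; last by move=> y; apply: order_ge_orb.
    rewrite -horner_coef0 horner_prod prodf_seq_neq0; apply/allP => _ /orbP[g ->] /=.
    rewrite hornerXsubC sub0r oppr_eq0 hpart2_act -(rmorph0 (act z g)).
    by rewrite (inj_eq (act_inj zP (g := g))) hpart2_order2_neq0.
  apply: contrapT => nex; case/eqP: h0; apply: fps2P => i j; rewrite coef2_hpart2 subn0.
  case: eqP => // ij; apply/eqP; apply: contrapT => /negP h.
  by apply: nex; exists i, j.
have [a0 [b0 [ab Fab]]] : exists a b, (m * (a + b) = w * N)%N /\ coef2 F`_0 a b != 0.
  move: Fij; rewrite -(map_minpolyR zP) coef_map /= [coef2 (puiseux_incl _ _) _ _]/coef2 /=.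
  case: ifP => [/andP[/dvdnP[a ia] /dvdnP[b jb]]|]; last by rewrite eqxx.
  by rewrite ia jb !mulnK // => Fab; exists a, b; split=> //; rewrite -ij ia jb mulnC mulnDl.
pose d := (a0 + b0)%N.
(* A nonzero term has m(a+b+c) >= wN + (m-w)c, and wN = md; as w < m, total degree [d] is the
   minimum and is reached only with c = 0. *)
have Flow a b c : (a + b + c <= d)%N -> (a + b + c < d)%N || (0 < c)%N ->
    coef2 F`_c a b = 0.
  move=> abc h; have [cN|cN] := leqP c N; last by rewrite coef_minpolyR_gt.
  apply: (minpolyR_coef_lt zP xw); rewrite -/N mulnBr.
  have : (m * (a + b + c) <= m * d)%N by rewrite leq_mul2l abc orbT.
  case/orP: h => h.
    have : (m * (a + b + c) < m * d)%N by rewrite ltn_mul2l.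
    by rewrite /d in ab *; nia.
  have : (w * c < m * c)%N by rewrite ltn_mul2r h.
  by rewrite /d in ab *; lia.
have coneE : tangent_cone_eq F = hpart3 d F.
  apply: tangent_cone_eqE => [|a b c abc]; last by rewrite Flow // ?abc // ltnW.
  apply: contraNneq Fab => /(congr1 (mcoeff (mnm3 a0 b0 0))).
  by rewrite mcoeff_hpart3 addn0 eqxx mcoeff0 => ->.
pose p : {poly C} := \poly_(a < d.+1) coef2 F`_0 a (d - a).
have pE a : p`_a = if (a < d.+1)%N then coef2 F`_0 a (d - a) else 0.
  exact: coef_poly.
have -> : tangent_cone_eq (minpolyR n z x) = homogenize d p.
  rewrite -/F coneE; apply/mpolyP => k; have [a [b [c ->]]] := mnm3_eta k.
  rewrite mcoeff_hpart3 mcoeff_homogenize; case: c => [|c].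
    rewrite addn0 andbT; case: eqP => // abd.
    by rewrite pE ltnS -abd leq_addr addKn.
  by rewrite andbF; case: eqP => // abc; rewrite Flow // ?abc ?orbT.
apply: homogenize_split; first exact: size_poly.
apply: contraNneq Fab => p0; have := congr1 (fun q : {poly C} => q`_a0) p0.
by rewrite pE coef0 ltnS leq_addr /d addKn => ->.
Qed.

End SmallOrder.
(** The zero series, of order [+oo], belongs to this case; it satisfies every bound [order_ge]. *)
Lemma nu_gt1 (C : idomainType) n (x : {fps2 C}) :
  (1%:E < nu n.+1 x)%E -> order_ge n.+2 x.
Proof.
rewrite /nu; have [->|x0] := eqVneq x 0; first by move=> _; apply: order_ge0.
rewrite lte_fin ltr_pdivlMr ?ltr0n // mul1r ltr_nat => h i j ij.
by apply: (order_ge_order2 x0); apply: leq_trans h.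
Qed.

Lemma nu_eq1 (C : idomainType) n (x : {fps2 C}) :
  nu n.+1 x = 1%:E -> x != 0 /\ order2 x = n.+1.
Proof.
rewrite /nu; have [//|x0] := eqVneq x 0.
move=> /(congr1 fine) /= h; split=> //.
have m0 : n.+1%:R != 0 :> rat by rewrite pnatr_eq0.
by move/(canRL (mulfVK m0))/eqP: h; rewrite mul1r eqr_nat => /eqP.
Qed.

Lemma nu_lt1 (C : idomainType) n (x : {fps2 C}) :
  (nu n.+1 x < 1%:E)%E -> x != 0 /\ (order2 x < n.+1)%N.
Proof.
rewrite /nu; have [//|x0] := eqVneq x 0.
by rewrite lte_fin ltr_pdivrMr ?ltr0n // mul1r ltr_nat.
Qed.

Unset Implicit Arguments.

Theorem mainTheorem1 (C : closedFieldType) (charC : [pchar C] =i pred0)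
    (m : nat) (m_gt0 : (0 < m)%N) (zeta : {fps2 C})
    (zetaP : forall i j : nat, exponents zeta (i, j) ->
       ~ ((m %| i)%N /\ (m %| j)%N))
    (F : {poly {fps2 C}}) (FP : minpoly_over_series m zeta F) :
  [/\ ((1%:E < nu m zeta)%E ->
        same_equation (tangent_cone_eq F) ('X_2 ^+ (size F).-1)),
      (nu m zeta = 1%:E ->
        exists G : {mpoly C[3]},
          [/\ irreducible_elt G,
              minpoly_over_series m (initial_form zeta) (mpoly_series G),
              (puiseux_d m zeta %| puiseux_d m (initial_form zeta))%N
            & same_equation (tangent_cone_eq F)
                (G ^+ (puiseux_d m (initial_form zeta) %/ puiseux_d m zeta))])
    & ((nu m zeta < 1%:E)%E ->
        exists2 s : seq {mpoly C[3]},
          (forall l, l \in s -> linear_form l)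
          & same_equation (tangent_cone_eq F) (\prod_(l <- s) l))].
Proof.
case: m m_gt0 zetaP FP => // n _ _; have [z zP] := has_primitive_root n charC.
move=> /(minpoly_over_seriesP zP) ->; split.
- move=> /nu_gt1 zeta_gt; rewrite (tangent_cone_order_gt zP zeta_gt).
  by rewrite (size_minpolyR zP); apply: same_equation_refl.
- move=> /nu_eq1[zeta0 zeta1].
  have zetam : order_ge n.+1 zeta by rewrite -zeta1; apply: order_ge_order2.
  rewrite /initial_form zeta1 !(puiseux_dE zP charC).
  have idem := hpart2_idem n.+1 zeta.
  exists (minform n z (hpart2 n.+1 zeta)); split.
  + exact: minform_irreducible.
  + by apply/(minpoly_over_seriesP zP); rewrite mpoly_series_minform.
  + exact: stab_hpart2_dvd.
  + by rewrite (tangent_cone_order_eq zP zetam); apply: same_equation_refl.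
- by move=> /nu_lt1[zeta0 zeta_lt]; apply: tangent_cone_order_lt.
Qed.
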